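(* Let $p$ be a prime and $e$ a positive integer with $e\mid p-1$ and $e\le (p-1)/2$. Given two oracles $\mathcal{O}_{e,s}$ and $\mathcal{O}_{e,t}$ for some unknown $s,t\in\mathbb{F}_p$, there is a deterministic algorithm which decides whether $s=t$ in time $\max\{e^{1/2}p^{o(1)},\, e^{2}p^{-1+o(1)}\}$ as $p\to\infty$.
   Context: For a prime $p$, a positive integer $e\mid p-1$ and a hidden element $s\in\mathbb{F}_p$, the oracle $\mathcal{O}_{e,s}$ is a black box which, on any input $x\in\mathbb{F}_p$, returns $(x+s)^e\in\mathbb{F}_p$. Running time counts bit operations, each oracle call having unit cost. *)

(* Defs.v *)
From Stdlib Require Import ZArith Reals.
From mathcomp Require Import all_boot.

Set Implicit Arguments.
Unset Strict Implicit.
Unset Printing Implicit Defensive.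

(* Machine model: deterministic multitape oracle Turing machines over the     *)
(* alphabet {blank, 0, 1} (cells are [option bool], [None] = blank).          *)
(* A machine has [k+4] tapes:                                                *)
(*   tape 0 : query tape of the first oracle  (O_{e,s})                      *)
(*   tape 1 : query tape of the second oracle (O_{e,t})                      *)
(*   tape 2 : holds p in binary (little endian) initially                    *)
(*   tape 3 : holds e in binary (little endian) initially                    *)
(*   tapes 4..k+3 : work tapes, initially blank.                              *)
(* Every ordinary step (one bit operation) costs 1, every oracle call costs 1.*)

Inductive move := MvL | MvS | MvR.

Inductive action (Q : Type) (n : nat) :=
| AHalt of bool
| AQuery of bool & Q                  (* call oracle (false: first, true: second),
                                         then go to the given state *)
| AStep of ({ffun 'I_n -> option bool} -> Q * {ffun 'I_n -> option bool * move}).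

Record OTM := {
  otm_k : nat;
  otm_Q : finType;
  otm_q0 : otm_Q;
  otm_act : otm_Q -> action otm_Q (otm_k.+4)
}.

Definition ntapes (M : OTM) := (otm_k M).+4.

Record config (M : OTM) := Config {
  cstate : otm_Q M;
  ctape  : 'I_(ntapes M) -> Z -> option bool;
  chead  : 'I_(ntapes M) -> Z
}.

Fixpoint bits_aux (fuel y : nat) : seq bool :=
  match fuel with
  | 0 => [::]
  | S f => if y == 0 then [::] else odd y :: bits_aux f y./2
  end.
Definition bits (y : nat) : seq bool := bits_aux y y.

Definition nat_tape (y : nat) : Z -> option bool :=
  fun i => if (0 <=? i)%Z && (Z.to_nat i < size (bits y))%N
           then Some (nth false (bits y) (Z.to_nat i)) else None.

Definition read_nat (tp : Z -> option bool) (h : Z) : nat :=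
  \sum_(i < Z.to_nat h) (if tp (Z.of_nat i) is Some true then 2 ^ i else 0).

Definition mv (m : move) : Z := match m with MvL => (-1)%Z | MvS => 0%Z | MvR => 1%Z end.

Definition tidx (M : OTM) (i : nat) : 'I_(ntapes M) := inord i.

Definition step (M : OTM) (O1 O2 : nat -> nat) (c : config M) : config M :=
  match @otm_act M (cstate c) with
  | AHalt _ => c
  | AQuery b q' =>
      let j := tidx M (if b then 1 else 0) in
      let x := read_nat (ctape c j) (chead c j) in
      let y := (if b then O2 else O1) x in
      @Config M q' (fun j' => if j' == j then nat_tape y else ctape c j')
                (fun j' => if j' == j then 0%Z else chead c j')
  | AStep d =>
      let syms := [ffun j => ctape c j (chead c j)] in
      let (q', w) := d syms in
      @Config M q'
        (fun j i => if (i =? chead c j)%Z then (w j).1 else ctape c j i)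
        (fun j => (chead c j + mv (w j).2)%Z)
  end.

Definition init_config (M : OTM) (p e : nat) : config M :=
  @Config M (@otm_q0 M)
    (fun j => if j == tidx M 2 then nat_tape p
              else if j == tidx M 3 then nat_tape e else (fun _ => None))
    (fun _ => 0%Z).

Definition halt_answer (M : OTM) (q : otm_Q M) : option bool :=
  match @otm_act M q with AHalt b => Some b | _ => None end.

(* the oracle O_{e,s} over F_p, elements of F_p represented by 0..p-1;
   a query x is read as the residue class of x mod p *)
Definition oracle (p e s : nat) : nat -> nat := fun x => ((x + s) ^ e) %% p.

Definition halts_within (M : OTM) (p e : nat) (O1 O2 : nat -> nat) (n : nat) (b : bool) :=
  exists m, (m <= n)%N /\
    halt_answer (cstate (iter m (step O1 O2) (init_config M p e))) = Some b.

Definition is_o1 (f : nat -> R) : Prop :=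
  forall eps : R, Rlt 0 eps -> exists N : nat, forall p : nat, (N <= p)%N -> Rlt (Rabs (f p)) eps.

(* Main.v *)
Require Import Defs.
From Stdlib Require Import ZArith Reals Lra FunctionalExtensionality.
From mathcomp Require Import all_boot zify.
From HB Require Import structures.

Set Implicit Arguments.
Unset Strict Implicit.
Unset Printing Implicit Defensive.

(* The machine compares the oracles on all x < H = 2^h, where, for p of a bits and e of b bits,
   h is about max(b/2, 2b - a) + O(a / log a), and accepts when they never differ.

   If s <> t and the oracles agree on [0, H), then (x + s)/(x + t) is an e-th root of unity for
   every x < H, and so is every product of two such ratios.  The products equal to 1 come from at
   most H pairs.  For any other value l, the equation (x + s)(y + s) = l (x + t)(y + t) is a
   hyperbola (x + c)(y + c) = m with m <> 0 mod p.  By Dirichlet's theorem there are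
   T <= T0 ~ (p/H)^(1/2) and |u| <= p/T0 with T c = u mod p; then K = T x y + u (x + y) has a fixed
   residue mod p and is O(T0 H^2 + H p / T0), so it takes O(1 + H^(3/2) p^(-1/2)) values, and for
   each of them (T x + u)(T y + u) = T K + u^2 is a fixed nonzero integer, hence has p^o(1)
   factorizations (Cilleruelo-Garaev).  Since there are at most e roots of unity,
   H^2 <= H + e p^o(1) (1 + H^(3/2) p^(-1/2)), which fails for the chosen H.

   The divisor bound tau(N)^k <= 2^(8^k) N with k ~ log_8 a dictates the O(a / log a) term of h; the
   machine produces it as the number of increments of a binary counter that consume the a
   bits of p when each increment costs the current length of the counter. *)

(** * Binary words and tapes *)

Fixpoint bval (w : seq bool) : nat := if w is b :: w' then b + (bval w').*2 else 0.

Fixpoint addc (c : bool) (w : seq bool) : seq bool * bool :=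
  if w is b :: w' then let r := addc (b && c) w' in (b (+) c :: r.1, r.2) else ([::], c).

(** A final carry becomes a new top bit, so words grow only on overflow; [addc] alone keeps the
    length and makes the query counter wrap around. *)
Definition inc (w : seq bool) := let r := addc true w in r.1 ++ nseq r.2 true.

Lemma size_addc c w : size (addc c w).1 = size w.
Proof. by elim: w c => //= b w IHw c; rewrite IHw. Qed.

Lemma bval_addc c w : bval (addc c w).1 + (addc c w).2 * 2 ^ size w = bval w + c.
Proof.
elim: w c => [|b w IHw] c /=; first by rewrite muln1.
by have := IHw (b && c); rewrite expnS; case: b c => [] []; lia.
Qed.

Lemma bval_cat u v : bval (u ++ v) = bval u + bval v * 2 ^ size u.
Proof. by elim: u => [|b u /= ->]; rewrite ?muln1 //= expnS; lia. Qed.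

Lemma bval_inc w : bval (inc w) = (bval w).+1.
Proof.
rewrite /inc bval_cat size_addc; have := bval_addc true w.
by case: (addc true w).2 => /=; lia.
Qed.

Lemma bval_lt w : bval w < 2 ^ size w.
Proof. by elim: w => //= b w; rewrite expnS; case: b; lia. Qed.

Lemma size_bits_aux_le f y : y <= f -> y < 2 ^ size (bits_aux f y) /\ bval (bits_aux f y) = y.
Proof.
elim: f y => [|f IHf] y /=; first by case: y.
move=> yf; case: eqP => [->//|y0] /=; have [] := IHf y./2; first by lia.
by rewrite expnS; have := odd_double_half y; lia.
Qed.

Lemma bval_bits y : bval (bits y) = y.
Proof. by case: (size_bits_aux_le (leqnn y)). Qed.

Lemma bits_inj : injective bits.
Proof. by move=> x y /(congr1 bval); rewrite !bval_bits. Qed.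

Lemma ltn_exp_size_bits y : y < 2 ^ size (bits y).
Proof. by case: (size_bits_aux_le (leqnn y)). Qed.

Lemma size_bits_exp_leq y : 0 < y -> 2 ^ (size (bits y)).-1 <= y.
Proof.
have gen f z : z <= f -> 0 < z -> 2 ^ (size (bits_aux f z)).-1 <= z.
  elim: f z => [|f IHf] z /=; first by case: z.
  move=> zf z0; rewrite gtn_eqF //=; have [z2|z2] := posnP z./2.
    by rewrite z2; case: (f).
  have := IHf z./2 ltac:(lia) z2.
  by case: (size _) => [|n] /=; rewrite ?expnS; lia.
exact: gen.
Qed.

Lemma size_bits_leq x y : x <= y -> size (bits x) <= size (bits y).
Proof.
case: (posnP x) => [->//|x0 xy]; rewrite leqNgt; apply/negP => H.
have := size_bits_exp_leq x0; have := ltn_exp_size_bits y.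
have : 2 ^ size (bits y) <= 2 ^ (size (bits x)).-1 by rewrite leq_exp2l //; lia.
lia.
Qed.

(** * Tapes carrying a word *)

Definition tape := (Z -> option bool)%type.

(** [nat_tape y] is [ltape (bits y)] by conversion; arbitrary words also allow the leading zeros of
    a counter of fixed length. *)
Definition ltape (w : seq bool) : tape :=
  fun i => if (0 <=? i)%Z && (Z.to_nat i < size w)%N then Some (nth false w (Z.to_nat i)) else None.

Definition upd (t : tape) (h : Z) (s : option bool) : tape :=
  fun i => if (i =? h)%Z then s else t i.

Lemma ltapeE w j : ltape w (Z.of_nat j) = if j < size w then Some (nth false w j) else None.
Proof. by rewrite /ltape Nat2Z.id; case: Z.leb_spec => //; lia. Qed.

Lemma ltape_pred w j : ltape w (Z.of_nat j - 1)%Z =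
  if 0 < j <= size w then Some (nth false w j.-1) else None.
Proof.
case: j => [|j]; first by []; rewrite (_ : (Z.of_nat j.+1 - 1)%Z = Z.of_nat j); last by lia.
exact: ltapeE.
Qed.

Lemma ltape_out w j : size w <= j -> ltape w (Z.of_nat j) = None.
Proof. by rewrite ltapeE ltnNge => ->. Qed.

Lemma ltape_mid u b v : ltape (u ++ b :: v) (Z.of_nat (size u)) = Some b.
Proof. by rewrite ltapeE size_cat /= nth_cat ltnn subnn ifT //; lia. Qed.

Lemma upd_id t h : upd t h (t h) = t.
Proof. by apply: functional_extensionality => i; rewrite /upd; case: Z.eqb_spec => // ->. Qed.

Lemma upd_out w j : size w <= j -> upd (ltape w) (Z.of_nat j) None = ltape w.
Proof. by move=> /ltape_out <-; rewrite upd_id. Qed.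

Lemma upd_mid u b b' v :
  upd (ltape (u ++ b :: v)) (Z.of_nat (size u)) (Some b') = ltape (u ++ b' :: v).
Proof.
apply: functional_extensionality => i; rewrite /upd; case: Z.eqb_spec => [->|ne].
  by rewrite ltape_mid.
rewrite /ltape !size_cat /=; case: Z.leb_spec => //= i0; case: ifP => // _.
by rewrite !nth_cat; case: ltnP => // l; case E: (_ - _) => [|n] //; lia.
Qed.

Lemma upd_end u b : upd (ltape u) (Z.of_nat (size u)) (Some b) = ltape (rcons u b).
Proof.
apply: functional_extensionality => i; rewrite /upd /ltape size_rcons nth_rcons.
case: Z.eqb_spec => [->|ne].
  by rewrite Nat2Z.id ltnn eqxx ltnS leqnn; case: Z.leb_spec => //; lia.
case: Z.leb_spec => //= i0; rewrite ltnS; case: (ltngtP (Z.to_nat i) (size u)) => // E; lia.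
Qed.

(** Weaker than [t = ltape u]: the cells beyond [u] are free, since a query tape may still carry the
    end of the previous oracle answer. [read_nat] looks only to the left of the head. *)
Definition holds (t : tape) (u : seq bool) := forall i, i < size u -> t (Z.of_nat i) = Some (nth false u i).

Lemma holds_nil t : holds t [::]. Proof. by []. Qed.

Lemma holds_upd t u b : holds t u -> holds (upd t (Z.of_nat (size u)) (Some b)) (rcons u b).
Proof.
move=> tu i; rewrite size_rcons ltnS nth_rcons /upd => iu.
case: Z.eqb_spec => [e|ne].
  by rewrite (_ : i = size u) ?ltnn ?eqxx //; lia.
by case: ltnP => [/tu//|]; lia.
Qed.

Lemma bval_sum w : \sum_(i < size w) (nth false w i) * 2 ^ i = bval w.
Proof.
elim: w => [|b w IHw] /=; first by rewrite big_ord0.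
rewrite big_ord_recl /= muln1 -IHw; congr (_ + _).
by rewrite -muln2 big_distrl /=; apply: eq_bigr => i _; rewrite -mulnA -expnSr.
Qed.

Lemma read_holds t u : holds t u -> read_nat t (Z.of_nat (size u)) = bval u.
Proof.
move=> tu; rewrite /read_nat Nat2Z.id -bval_sum; apply: eq_bigr => i _.
by rewrite tu //; case: nth; rewrite ?mul1n.
Qed.

(** * The machine *)

Inductive state :=
| Mark of 'I_128 | Sweep of bool | Back
| EPair | EStep2 | EStep3 | EStep4
| Ret of bool | Copy of bool | Ask1 of bool | Ask2 of bool | Cmp of bool | Halt of bool.

(** An injective encoding into a finite type, from which [state] inherits its finite type
    structure. *)
Definition state_code (q : state) : 'I_13 * 'I_128 * bool :=
  let o i b : 'I_13 * 'I_128 * bool := (inord i, ord0, b) in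
  match q with
  | Mark i => (inord 0, i, false) | Sweep c => o 1 c | Back => o 2 false
  | EPair => o 3 false | EStep2 => o 4 false | EStep3 => o 5 false | EStep4 => o 6 false
  | Ret c => o 7 c | Copy c => o 8 c | Ask1 c => o 9 c | Ask2 c => o 10 c
  | Cmp c => o 11 c | Halt c => o 12 c
  end.

Definition state_decode (x : 'I_13 * 'I_128 * bool) : state :=
  let: (k, i, c) := x in
  match nat_of_ord k with
  | 0 => Mark i | 1 => Sweep c | 2 => Back | 3 => EPair | 4 => EStep2 | 5 => EStep3 | 6 => EStep4
  | 7 => Ret c | 8 => Copy c | 9 => Ask1 c | 10 => Ask2 c | 11 => Cmp c | _ => Halt c
  end.

Lemma state_codeK : cancel state_code state_decode.
Proof. by case=> [i|c||||||c|c|c|c|c|c]; rewrite /state_decode /= inordK. Qed.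

HB.instance Definition _ := Equality.copy state (can_type state_codeK).
HB.instance Definition _ := Choice.copy state (can_type state_codeK).
HB.instance Definition _ := Countable.copy state (can_type state_codeK).
HB.instance Definition _ := Finite.copy state (can_type state_codeK).

Definition cell := option bool.
Definition stay (x : cell) := (x, MvS).
Definition moveL (x : cell) := (x, MvL).
Definition moveR (x : cell) := (x, MvR).
Definition back (x : cell) := if x is Some _ then moveL x else stay x.

(** Of the three steps built from it, only [EStep2] moves on [e], as [EPair] does, so a round passes
    two cells of [e]; for odd length the last of them is blank, hence the [uphalf] in the final
    count. *)
Definition econsume (q' : state) (a b p e x : cell) (me : move) :=
  if p is Some _ then (q', [:: stay a; stay b; moveL p; (e, me); stay x])
  else (q', [:: stay a; stay b; stay p; (e, me); moveR (Some false)]).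

(* Tapes [a], [b] are the query tapes, [p], [e] the inputs and [x] the query counter; while the
   length of the counter is being computed, [a] carries the binary counter that consumes [p].
   - [Mark], [Sweep], [Back]: write 128 zeros on [x], increment [a] moving along [p], rewind [a];
   - [EPair], ..., [EStep4]: for every two bits of [e], one zero on [x] plus one for each of
     three further steps for which [p], now read backwards, is exhausted;
   - [Ret], [Copy], [Ask1], [Ask2], [Cmp]: rewind, copy [x] to both query tapes while incrementing
     it, query, compare; the flag is the carry, so [Ret true] means that all values were tried. *)
Definition delta (q : state) (a b p e x : cell) : state * seq (cell * move) :=
  match q with
  | Mark i => (if i == ord0 then Sweep true else Mark (inord i.-1),
               [:: stay a; stay b; stay p; stay e; moveR (Some false)])
  | Sweep c =>
      match p, a with
      | None, _ => (EPair, [:: moveL a; moveL b; moveL p; stay e; stay x])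
      | Some _, Some d => (Sweep (d && c), [:: moveR (Some (d (+) c)); stay b; moveR p; stay e; stay x])
      | Some _, None => (Back, [:: moveL (if c then Some true else None); stay b; stay p; stay e; stay x])
      end
  | Back => if a is Some _ then (Back, [:: moveL a; stay b; stay p; stay e; stay x])
            else (Mark ord_max, [:: moveR a; stay b; stay p; stay e; stay x])
  | EPair => if e is Some _ then (EStep2, [:: stay a; stay b; stay p; moveR e; moveR (Some false)])
             else (Ret false, [:: stay a; stay b; stay p; stay e; moveL x])
  | EStep2 => econsume EStep3 a b p e x MvR
  | EStep3 => econsume EStep4 a b p e x MvS
  | EStep4 => econsume EPair a b p e x MvS
  | Ret c =>
      if [&& ~~ isSome a, ~~ isSome b & ~~ isSome x]
      then (if c then Halt true else Copy true, [:: moveR a; moveR b; stay p; stay e; moveR x])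
      else (Ret c, [:: back a; back b; stay p; stay e; back x])
  | Copy c =>
      if x is Some d
      then (Copy (d && c), [:: moveR x; moveR x; stay p; stay e; moveR (Some (d (+) c))])
      else (Ask1 c, [:: stay a; stay b; stay p; stay e; stay x])
  | Cmp c =>
      if a != b then (Halt false, [:: stay a; stay b; stay p; stay e; stay x])
      else if a is Some _ then (Cmp c, [:: moveR a; moveR b; stay p; stay e; stay x])
      else (Ret c, [:: moveL a; moveL b; stay p; stay e; moveL x])
  | q => (q, [::])
  end.

Definition machine_act (q : state) : action state 5 :=
  match q with
  | Halt b => AHalt state 5 b
  | Ask1 c => AQuery 5 false (Ask2 c)
  | Ask2 c => AQuery 5 true (Cmp c)
  | q => AStep (fun f => let r := delta q (f (inord 0)) (f (inord 1)) (f (inord 2))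
                                       (f (inord 3)) (f (inord 4)) in
                 (r.1, [ffun j : 'I_5 => nth (None, MvS) r.2 j]))
  end.

Definition machine : OTM := @Build_OTM 1 state (Mark ord_max) machine_act.

Definition conf (q : state) (ts : seq (tape * Z)) : config machine :=
  @Config machine q (fun j => (nth (ltape [::], 0%Z) ts j).1) (fun j => (nth (ltape [::], 0%Z) ts j).2).

Lemma eq_conf q (T : 'I_5 -> tape) (h : 'I_5 -> Z) ts :
  size ts = 5 -> (forall i (i5 : i < 5), (T (Ordinal i5), h (Ordinal i5)) = nth (ltape [::], 0%Z) ts i) ->
  @Config machine q T h = conf q ts.
Proof.
move=> s5 E; rewrite /conf; congr (@Config machine); apply: functional_extensionality => -[i i5];
  by have := E i i5; case: nth => ? ? /= [].
Qed.

(** * Single steps and bounded runs *)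

Section Run.
Variables (O1 O2 : nat -> nat).
Local Notation st := (@step machine O1 O2).

Definition is_step_state q := match q with Halt _ | Ask1 _ | Ask2 _ => false | _ => true end.

Lemma step_conf q q' t0 t1 t2 t3 t4 h0 h1 h2 h3 h4 s0 s1 s2 s3 s4 m0 m1 m2 m3 m4 :
  is_step_state q ->
  delta q (t0 h0) (t1 h1) (t2 h2) (t3 h3) (t4 h4)
    = (q', [:: (s0, m0); (s1, m1); (s2, m2); (s3, m3); (s4, m4)]) ->
  st (conf q [:: (t0, h0); (t1, h1); (t2, h2); (t3, h3); (t4, h4)]) =
  conf q' [:: (upd t0 h0 s0, h0 + mv m0)%Z; (upd t1 h1 s1, h1 + mv m1)%Z;
              (upd t2 h2 s2, h2 + mv m2)%Z; (upd t3 h3 s3, h3 + mv m3)%Z;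
              (upd t4 h4 s4, h4 + mv m4)%Z].
Proof.
move=> qs D; rewrite /step /=.
have -> : machine_act q = AStep (fun f => let r := delta q (f (inord 0)) (f (inord 1)) (f (inord 2))
                                       (f (inord 3)) (f (inord 4)) in
                 (r.1, [ffun j : 'I_5 => nth (None, MvS) r.2 j])) by case: (q) qs.
rewrite /= !ffunE /= !inordK //= D /=.
apply: eq_conf => // i i5; rewrite !ffunE /=.
by case: i i5 => [|[|[|[|[|i]]]]] i5 //=.
Qed.

Lemma step_ask b c t0 t1 t2 t3 t4 h0 h1 h2 h3 h4 :
  st (conf (if b then Ask2 c else Ask1 c) [:: (t0, h0); (t1, h1); (t2, h2); (t3, h3); (t4, h4)]) =
  if b then conf (Cmp c) [:: (t0, h0); (nat_tape (O2 (read_nat t1 h1)), 0%Z); (t2, h2); (t3, h3); (t4, h4)]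
  else conf (Ask2 c) [:: (nat_tape (O1 (read_nat t0 h0)), 0%Z); (t1, h1); (t2, h2); (t3, h3); (t4, h4)].
Proof.
have tE i : i < 5 -> tidx machine i = i :> nat by move=> i5; rewrite /tidx inordK.
by case: b; rewrite /step /=; apply: eq_conf => // i i5; rewrite !tE // -!val_eqE /= !tE //;
  case: i i5 => [|[|[|[|[|i]]]]] i5 //=.
Qed.

(** The number of steps is only bounded, so that costs can be rounded up when runs are composed. *)
Definition reach n c c' := exists2 m, m <= n & iter m st c = c'.

Lemma reach_refl c : reach 0 c c. Proof. by exists 0. Qed.

Lemma reach_step n c c1 c' : st c = c1 -> reach n c1 c' -> reach n.+1 c c'.
Proof. by move=> <- [m mn <-]; exists m.+1; rewrite // iterSr. Qed.

Lemma reach_trans n1 n2 n c c1 c' : reach n1 c c1 -> reach n2 c1 c' -> n1 + n2 <= n -> reach n c c'.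
Proof. by move=> [m1 l1 <-] [m2 l2 <-] le_n; exists (m2 + m1); rewrite ?iterD //; lia. Qed.

Lemma reach_le n1 n2 c c' : reach n1 c c' -> n1 <= n2 -> reach n2 c c'.
Proof. by move=> [m l1 <-] l2; exists m => //; lia. Qed.

End Run.

Lemma addZ1 n : (Z.of_nat n + 1)%Z = Z.of_nat n.+1. Proof. lia. Qed.
Lemma subZ1 z : (z + -1)%Z = (z - 1)%Z. Proof. by []. Qed.
Lemma predZ n : (Z.of_nat n.+1 - 1)%Z = Z.of_nat n. Proof. lia. Qed.
Lemma subZ1K z : (z - 1 + 1)%Z = z. Proof. lia. Qed.
Definition headE := (Z.add_0_r, addZ1, subZ1, predZ, subZ1K, upd_id).

(** * The phases of the machine and their costs *)

Section Run.
Variables (O1 O2 : nat -> nat).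
Local Notation reach := (@reach O1 O2).
Local Notation Zn := Z.of_nat.

Lemma mark_run i t0 t1 t2 t3 h0 h1 h2 h3 x : i < 128 ->
  reach i.+1
    (conf (Mark (inord i)) [:: (t0, h0); (t1, h1); (t2, h2); (t3, h3); (ltape x, Zn (size x))])
    (conf (Sweep true) [:: (t0, h0); (t1, h1); (t2, h2); (t3, h3);
       (ltape (x ++ nseq i.+1 false), Zn (size x + i.+1))]).
Proof.
elim: i x => [|i IHi] x i_lt; (apply: reach_step; first exact: step_conf); rewrite -val_eqE /= inordK //=.
  by rewrite !headE upd_end -cats1 addn1; apply: reach_refl.
rewrite !headE upd_end addnS -addSn -(size_rcons x false).
by rewrite -cat_rcons; apply: IHi; lia.
Qed.

Lemma mark_run_max t0 t1 t2 t3 h0 h1 h2 h3 x :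
  reach 128
    (conf (Mark ord_max) [:: (t0, h0); (t1, h1); (t2, h2); (t3, h3); (ltape x, Zn (size x))])
    (conf (Sweep true) [:: (t0, h0); (t1, h1); (t2, h2); (t3, h3);
       (ltape (x ++ nseq 128 false), Zn (size x + 128))]).
Proof.
rewrite (_ : ord_max = inord 127); first exact: mark_run.
by apply: val_inj; rewrite /= inordK.
Qed.

(** A ripple-carry pass with the carry in the state; each counter bit handled uses up one cell of
    [P]. The suffix [v2] serves the last sweep, where [P] may end before the counter does. *)
Lemma sweep_run u v1 v2 c k P t1 t3 t4 h1 h3 h4 : k + size v1 <= size P ->
  reach (size v1)
    (conf (Sweep c) [:: (ltape (u ++ v1 ++ v2), Zn (size u)); (t1, h1); (ltape P, Zn k); (t3, h3); (t4, h4)])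
    (conf (Sweep (addc c v1).2) [:: (ltape (u ++ (addc c v1).1 ++ v2), Zn (size u + size v1)); (t1, h1);
       (ltape P, Zn (k + size v1)); (t3, h3); (t4, h4)]).
Proof.
elim: v1 u c k => [|d v1 IHv] u c k /= kP; first by rewrite !addn0; apply: reach_refl.
apply: reach_step; first by apply: step_conf => //=; rewrite ltapeE ifT ?ltape_mid //; lia.
rewrite /= !headE upd_mid -cat_rcons -cat_rcons.
rewrite -[X in upd _ _ (Some X)]/(nth false P k) .
have -> : Some (nth false P k) = ltape P (Zn k) by rewrite ltapeE ifT //; lia.
rewrite headE -(size_rcons u (d (+) c)) !addnS -!addSn -(size_rcons u (d (+) c)).
by apply: IHv; lia.
Qed.

(** Writing the head position as [Zn i - 1] lets [i = 0] stand for the blank cell left of the word,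
    where rewinding stops. *)
Lemma back_run i w t1 t2 t3 t4 h1 h2 h3 h4 : i <= size w ->
  reach i.+1
    (conf Back [:: (ltape w, (Zn i - 1)%Z); (t1, h1); (t2, h2); (t3, h3); (t4, h4)])
    (conf (Mark ord_max) [:: (ltape w, 0%Z); (t1, h1); (t2, h2); (t3, h3); (t4, h4)]).
Proof.
elim: i => [|i IHi] i_le.
  apply: reach_step; first by apply: step_conf => //=.
  by rewrite !headE; apply: reach_refl.
apply: reach_step; first by apply: step_conf => //; rewrite ltape_pred i_le.
rewrite !headE.
have -> : upd (ltape w) (Zn i) (Some (nth false w i)) = ltape w.
  by rewrite -[RHS](upd_id _ (Zn i)) ltapeE i_le.
by apply: IHi; lia.
Qed.

(** The strict inequality keeps the head of [P] on a symbol when the counter ends, so that the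
    machine turns to [Back] and not to [EPair]. *)
Lemma sweep_cycle w k x P t1 t3 h1 h3 : k + size w < size P ->
  reach (132 + 2 * size w)
    (conf (Mark ord_max) [:: (ltape w, 0%Z); (t1, h1); (ltape P, Zn k); (t3, h3); (ltape x, Zn (size x))])
    (conf (Mark ord_max) [:: (ltape (inc w), 0%Z); (t1, h1); (ltape P, Zn (k + size w)); (t3, h3);
       (ltape (x ++ nseq 128 false), Zn (size x + 128))]).
Proof.
move=> kP; have := mark_run_max (ltape w) t1 (ltape P) t3 0 h1 (Zn k) h3 x.
set X := x ++ _; move: (Zn (_ + _)) => hX markX; apply: reach_trans; [exact: markX| |].
  apply: reach_trans; first by have := @sweep_run [::] w [::] true k P t1 t3 _ h1 h3 _ (ltnW kP); rewrite /= !cats0; apply.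
    rewrite add0n.
    set r := addc true w; have sr : size r.1 = size w by rewrite /r size_addc.
    apply: reach_step.
      apply: step_conf => //=; rewrite (@ltape_out r.1) ?sr // (@ltapeE P) kP; exact: erefl.
    rewrite /= !headE.
    have -> : Some (nth false P (k + size w)) = ltape P (Zn (k + size w)) by rewrite ltapeE kP.
    rewrite headE -sr.
    have -> : upd (ltape r.1) (Zn (size r.1)) (if r.2 then Some true else None) = ltape (inc w).
      rewrite /inc -/r; case: r.2 => /=; first by rewrite upd_end cats1.
      by rewrite upd_out // cats0.
     apply: (@back_run (size r.1)); rewrite /inc -/r size_cat; lia.
  exact: leqnn.

by rewrite size_addc; lia.
Qed.


(** [Sweep] tests for the end of [P] first, so equality on the right also ends here. The counter has
    served its purpose: only its head position [i] is kept, for the cost of the later rewind. *)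
Lemma last_sweep w k x P E : k <= size P <= k + size w ->
  exists i w', i <= minn (size w') (size P) /\ reach (130 + size w)
    (conf (Mark ord_max) [:: (ltape w, 0%Z); (ltape [::], 0%Z); (ltape P, Zn k); (ltape E, 0%Z);
       (ltape x, Zn (size x))])
    (conf EPair [:: (ltape w', (Zn i - 1)%Z); (ltape [::], (Zn 0 - 1)%Z);
       (ltape P, (Zn (size P) - 1)%Z); (ltape E, 0%Z);
       (ltape (x ++ nseq 128 false), Zn (size x + 128))]).
Proof.
move=> /andP[kP Pk]; have := mark_run_max (ltape w) (ltape [::]) (ltape P) (ltape E) 0 0 (Zn k) 0 x.
set X := x ++ _; move: (Zn (_ + _)) => hX markX.
set v := take (size P - k) w; set v' := drop (size P - k) w.
have sv : size v = size P - k by rewrite size_take; case: ltngtP; lia.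
exists (size v), ((addc true v).1 ++ v'); split; first by rewrite size_cat size_addc sv; lia.
apply: reach_trans; [exact: markX| |].
  apply: reach_trans.
    have kvP : k + size v <= size P by lia.
    have := @sweep_run [::] v v' true k P (ltape [::]) (ltape E) (ltape X) 0%Z 0%Z hX kvP.
    by rewrite /= cat_take_drop; apply.
  rewrite add0n (_ : k + size v = size P); last by lia.
  apply: reach_step; first by apply: step_conf => //; rewrite (@ltape_out P).
  rewrite !headE upd_out // (_ : (0 - 1)%Z = (Zn 0 - 1)%Z) //; exact: reach_refl.
  exact: leqnn.
by rewrite sv; lia.
Qed.

(** The truncated [i.-1] matches the head of [P], which stays on the blank cell once it gets there;
    from then on each step writes a zero. *)
Lemma econsume_step q q' me t0 t1 h0 h1 P i tE hE n : is_step_state q ->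
  (forall a b p e x, delta q a b p e x = econsume q' a b p e x me) -> i <= size P ->
  @step machine O1 O2 (conf q [:: (t0, h0); (t1, h1); (ltape P, (Zn i - 1)%Z); (tE, hE);
                                  (ltape (nseq n false), Zn n)]) =
  conf q' [:: (t0, h0); (t1, h1); (ltape P, (Zn i.-1 - 1)%Z); (tE, (hE + mv me)%Z);
              (ltape (nseq (n + (i == 0)) false), Zn (n + (i == 0)))].
Proof.
move=> qs D iP; rewrite -[in Zn n](size_nseq n false); case: i iP => [|i] iP.
  have e : delta q (t0 h0) (t1 h1) (ltape P (Zn 0 - 1)%Z) (tE hE)
      (ltape (nseq n false) (Zn (size (nseq n false)))) =
    (q', [:: stay (t0 h0); stay (t1 h1); stay (ltape P (Zn 0 - 1)%Z); (tE hE, me); moveR (Some false)]).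
    by rewrite D.
  rewrite (step_conf _ _ qs e) /mv.
  by rewrite !headE upd_end size_nseq addn1 -cats1 -[[:: false]]/(nseq 1 false) -nseqD addn1.
have e : delta q (t0 h0) (t1 h1) (ltape P (Zn i.+1 - 1)%Z) (tE hE)
    (ltape (nseq n false) (Zn (size (nseq n false)))) =
  (q', [:: stay (t0 h0); stay (t1 h1); moveL (ltape P (Zn i.+1 - 1)%Z); (tE hE, me);
   stay (ltape (nseq n false) (Zn (size (nseq n false))))]).
  by rewrite D /econsume ltape_pred iP.
rewrite (step_conf _ _ qs e) /= !headE size_nseq addn0.
by rewrite (_ : (Z.pos _ - 1 - 1)%Z = (Zn i - 1)%Z); last by lia.
Qed.

(** Each of the [r] rounds uses two cells of [E] and three of [P]. With truncated subtraction
    [r + (3 r - a) = max(r, 4 r - a)], which for [r] about [b/2] is the required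
    [max(b/2, 2 b - a)]. *)
Lemma epair_run r j i n P E t0 t1 h0 h1 :
  i <= size P -> size E <= 2 * (j + r) < (size E).+2 ->
  reach (4 * r).+1
    (conf EPair [:: (t0, h0); (t1, h1); (ltape P, (Zn i - 1)%Z); (ltape E, Zn (2 * j));
                    (ltape (nseq n false), Zn n)])
    (conf (Ret false) [:: (t0, h0); (t1, h1); (ltape P, (Zn (i - 3 * r) - 1)%Z); (ltape E, Zn (2 * (j + r)));
                    (ltape (nseq (n + r + (3 * r - i)) false), (Zn (n + r + (3 * r - i)) - 1)%Z)]).
Proof.
elim: r j i n => [|r IHr] j i n iP jr.
  apply: reach_step; first by apply: step_conf => //; rewrite (@ltape_out E) //; lia.
  rewrite !headE upd_out; last by lia.
  rewrite !muln0 !addn0 subn0; exact: reach_refl.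
have jE : 2 * j < size E by lia.
rewrite (_ : (4 * r.+1).+1 = (4 * r).+1.+4); last by lia.
apply: reach_step; first by apply: step_conf => //; rewrite (@ltapeE E) jE.
have -> : Some (nth false E (2 * j)) = ltape E (Zn (2 * j)) by rewrite ltapeE jE.
rewrite !headE -[in X in upd _ X _](size_nseq n false) upd_end -cats1 -[[:: false]]/(nseq 1 false) -nseqD -[n.+1]addn1.
do 3 (apply: reach_step; first by apply: econsume_step => //; lia).
rewrite /mv !headE !addn1 -!addnA.
have -> : n.+1 + ((i == 0) + ((i.-1 == 0) + (i.-2 == 0))) = n + (1 + (3 - i)) by lia.
have -> : (2 * j).+2 = 2 * j.+1 by lia.
rewrite (_ : i - 3 * r.+1 = i.-1.-2 - 3 * r); last by lia.
rewrite (_ : j + r.+1 = j.+1 + r); last by lia.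
rewrite (_ : n + (r.+1 + (3 * r.+1 - i)) = n + (1 + (3 - i)) + r + (3 * r - i.-1.-2)); last by lia.
by apply: IHr; lia.
Qed.

Lemma back_ltape w i : i <= size w ->
  [/\ (upd (ltape w) (Zn i - 1)%Z (back (ltape w (Zn i - 1)%Z)).1) = ltape w,
      ((Zn i - 1) + mv (back (ltape w (Zn i - 1)%Z)).2 = Zn i.-1 - 1)%Z
    & isSome (ltape w (Zn i - 1)%Z) = (0 < i)].
Proof.
move=> iw; have -> : (back (ltape w (Zn i - 1)%Z)).1 = ltape w (Zn i - 1)%Z by case: (ltape _ _).
rewrite upd_id; have := ltape_pred w i; rewrite iw andbT => ->.
by case: i {iw} => [|i]; split=> //; rewrite [mv _]/=; lia.
Qed.

Lemma ret_run n c wa wb wx ia ib ix t2 t3 h2 h3 :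
  ia <= size wa -> ib <= size wb -> ix <= size wx -> maxn ia (maxn ib ix) <= n ->
  reach n.+1
    (conf (Ret c) [:: (ltape wa, (Zn ia - 1)%Z); (ltape wb, (Zn ib - 1)%Z); (t2, h2); (t3, h3);
                      (ltape wx, (Zn ix - 1)%Z)])
    (conf (if c then Halt true else Copy true)
       [:: (ltape wa, 0%Z); (ltape wb, 0%Z); (t2, h2); (t3, h3); (ltape wx, 0%Z)]).
Proof.
elim: n ia ib ix => [|n IHn] ia ib ix aw bw xw le_n;
  have [ua ma sa] := back_ltape aw; have [ub mb sb] := back_ltape bw;
  have [ux mx sx] := back_ltape xw;
  case z: [&& ia == 0, ib == 0 & ix == 0].
- move: z => /and3P[/eqP za /eqP zb /eqP zx]; rewrite za zb zx.
  apply: reach_step; first by apply: step_conf.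
  by rewrite !headE; apply: reach_refl.
- by lia.
- move: z => /and3P[/eqP za /eqP zb /eqP zx]; rewrite za zb zx.
  apply: reach_step; first by apply: step_conf.
  by rewrite !headE; apply: reach_le (leq0n _); apply: reach_refl.
have e : delta (Ret c) (ltape wa (Zn ia - 1)%Z) (ltape wb (Zn ib - 1)%Z) (t2 h2) (t3 h3)
    (ltape wx (Zn ix - 1)%Z) =
    (Ret c, [:: back (ltape wa (Zn ia - 1)%Z); back (ltape wb (Zn ib - 1)%Z); stay (t2 h2);
                stay (t3 h3); back (ltape wx (Zn ix - 1)%Z)]).
  by rewrite /delta sa sb sx ifF //; lia.
move: e ua ma ub mb ux mx.
case: (back (ltape wa _)) => ? ?; case: (back (ltape wb _)) => ? ?; case: (back (ltape wx _)) => ? ?.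
move=> e /= ua ma ub mb ux mx; apply: reach_step; first exact: (step_conf O1 O2 (q := Ret c) isT e).
by rewrite ua ub ux ma mb mx /mv !headE; apply: IHn; lia.
Qed.

(** The query tapes receive the old bits while the counter is overwritten by its successor, so a
    single pass does both. *)
Lemma copy_run u u' v c tA tB t2 t3 h2 h3 : holds tA u -> holds tB u -> size u' = size u ->
  exists tA' tB', [/\ holds tA' (u ++ v), holds tB' (u ++ v) & reach (size v)
    (conf (Copy c) [:: (tA, Zn (size u)); (tB, Zn (size u)); (t2, h2); (t3, h3);
                       (ltape (u' ++ v), Zn (size u))])
    (conf (Copy (addc c v).2) [:: (tA', Zn (size (u ++ v))); (tB', Zn (size (u ++ v))); (t2, h2); (t3, h3);
                       (ltape (u' ++ (addc c v).1), Zn (size (u ++ v)))])].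
Proof.
elim: v u u' c tA tB => [|d v IHv] u u' c tA tB hA hB su.
  by exists tA, tB; rewrite !cats0; split=> //; apply: reach_refl.
have su' : size (rcons u' (d (+) c)) = size (rcons u d) by rewrite !size_rcons su.
have [tA' [tB' [hA' hB' R]]] := IHv _ _ (d && c) _ _ (holds_upd (b := d) hA) (holds_upd (b := d) hB) su'.
exists tA', tB'; rewrite -cat_rcons; split=> //=.
apply: reach_step.
  by apply: step_conf => //; rewrite (_ : ltape _ _ = Some d) // -su ltape_mid.
rewrite /mv !headE -[in X in upd (ltape _) X _]su upd_mid -!cat_rcons.
by move: R; rewrite size_rcons.
Qed.

(** The comparison goes on to the first blank, so a proper prefix also counts as different. Applied
    to words [bits y], which are canonical, it decides equality of the numbers. *)
Lemma cmp_run u v1 v2 c wx t2 t3 h2 h3 :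
  let start := conf (Cmp c) [:: (ltape (u ++ v1), Zn (size u)); (ltape (u ++ v2), Zn (size u));
                 (t2, h2); (t3, h3); (ltape wx, Zn (size wx))] in
  if v1 == v2 then
    reach (size v1).+1 start
      (conf (Ret c) [:: (ltape (u ++ v1), (Zn (size (u ++ v1)) - 1)%Z);
        (ltape (u ++ v1), (Zn (size (u ++ v1)) - 1)%Z); (t2, h2); (t3, h3);
        (ltape wx, (Zn (size wx) - 1)%Z)])
  else exists ts, reach (size v1).+1 start (conf (Halt false) ts).
Proof.
have differ w1 w2 n : ltape w1 (Zn n) != ltape w2 (Zn n) ->
    exists ts, reach 1 (conf (Cmp c) [:: (ltape w1, Zn n); (ltape w2, Zn n);
                 (t2, h2); (t3, h3); (ltape wx, Zn (size wx))]) (conf (Halt false) ts).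
  move=> ne; eexists; apply: reach_step; last exact: reach_refl.
  by apply: step_conf => //; rewrite /delta ne.
elim: v1 v2 u => [|d1 v1 IHv] [|d2 v2] u /=.
- rewrite cats0; apply: reach_step.
    by apply: step_conf => //; rewrite /delta eqxx (@ltape_out u).
  by rewrite /mv !headE !upd_out //; apply: reach_refl.
- by apply: differ; rewrite cats0 ltape_mid ltape_out.
- have [ts R] : exists ts, reach 1 (conf (Cmp c) [:: (ltape (u ++ d1 :: v1), Zn (size u)); (ltape (u ++ [::]), Zn (size u));
                 (t2, h2); (t3, h3); (ltape wx, Zn (size wx))]) (conf (Halt false) ts).
    by apply: differ; rewrite cats0 ltape_mid ltape_out.
  by exists ts; apply: reach_le R _.
have [<-|ne] := eqVneq d1 d2; last first.
  rewrite eqseq_cons (negbTE ne) /=.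
  have [ts R] := differ (u ++ d1 :: v1) (u ++ d2 :: v2) (size u) ltac:(by rewrite !ltape_mid).
  by exists ts; apply: reach_le R _.
have stepE : @step machine O1 O2 (conf (Cmp c) [:: (ltape (u ++ d1 :: v1), Zn (size u));
     (ltape (u ++ d1 :: v2), Zn (size u)); (t2, h2); (t3, h3); (ltape wx, Zn (size wx))]) =
   conf (Cmp c) [:: (ltape (rcons u d1 ++ v1), Zn (size (rcons u d1)));
     (ltape (rcons u d1 ++ v2), Zn (size (rcons u d1))); (t2, h2); (t3, h3); (ltape wx, Zn (size wx))].
  set w1 := u ++ d1 :: v1; set w2 := u ++ d1 :: v2.
  have e : delta (Cmp c) (ltape w1 (Zn (size u))) (ltape w2 (Zn (size u))) (t2 h2) (t3 h3)
      (ltape wx (Zn (size wx))) =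
    (Cmp c, [:: moveR (ltape w1 (Zn (size u))); moveR (ltape w2 (Zn (size u))); stay (t2 h2);
                stay (t3 h3); stay (ltape wx (Zn (size wx)))]).
    by rewrite /delta /w1 /w2 !ltape_mid eqxx.
  by rewrite (step_conf O1 O2 (q := Cmp c) isT e) /mv !headE size_rcons !cat_rcons.
have := IHv v2 (rcons u d1); rewrite /= eqseq_cons eqxx /= !cat_rcons.
case: eqP => [_ R|_ [ts R]]; last exists ts; by apply: reach_step stepE _; rewrite !cat_rcons.
Qed.

Lemma round_run w L tA tB t2 t3 h2 h3 :
  let y1 := O1 (bval w) in let y2 := O2 (bval w) in
  size (bits y1) <= L ->
  let start := conf (Copy true) [:: (tA, 0%Z); (tB, 0%Z); (t2, h2); (t3, h3); (ltape w, 0%Z)] in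
  let r := addc true w in
  let N := (2 * size w + 2 * L + 10)%N in
  if y1 == y2 then
    reach N start
      (conf (if r.2 then Halt true else Copy true)
         [:: (ltape (bits y1), 0%Z); (ltape (bits y1), 0%Z); (t2, h2); (t3, h3); (ltape r.1, 0%Z)])
  else exists ts, reach N start (conf (Halt false) ts).
Proof.
move=> y1 y2 yL start r N.
have [tA' [tB' [hA hB R1]]] := @copy_run [::] [::] w true tA tB t2 t3 h2 h3 (@holds_nil _) (@holds_nil _) erefl.
rewrite /= -/r in hA hB R1.
have sr : size r.1 = size w by rewrite size_addc.
have R2 : reach 3 (conf (Copy r.2) [:: (tA', Zn (size w)); (tB', Zn (size w)); (t2, h2); (t3, h3);
                       (ltape r.1, Zn (size w))])
   (conf (Cmp r.2) [:: (ltape ([::] ++ bits y1), 0%Z); (ltape ([::] ++ bits y2), 0%Z); (t2, h2); (t3, h3);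
                       (ltape r.1, Zn (size r.1))]).
  apply: reach_step; first by apply: step_conf => //; rewrite (@ltape_out r.1) ?sr.
  rewrite /mv !headE upd_out ?sr //.
  apply: reach_step; first exact: (step_ask _ _ false).
  rewrite (read_holds hA); apply: reach_step; first exact: (step_ask _ _ true).
  by rewrite (read_holds hB); apply: reach_refl.
have R12 := reach_trans R1 R2 (leqnn _).
have := @cmp_run [::] (bits y1) (bits y2) r.2 r.1 t2 t3 h2 h3.
rewrite /= (inj_eq bits_inj); case: eqP => [_ R3|_ [ts R3]]; last first.
  by exists ts; apply: (reach_trans R12 R3); rewrite /N; lia.
have R4 := @ret_run (maxn (size (bits y1)) (size w)) r.2 (bits y1) (bits y1) r.1 _ _ _ t2 t3 h2 h3
   (leqnn _) (leqnn _) (leqnn _).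
apply: (reach_trans (reach_trans R12 R3 (leqnn _)) (R4 _)); first by rewrite sr; lia.
by rewrite /N; lia.
Qed.

(** Here [n.+1] values are left before the counter overflows; the carry out of the increment is
    therefore set in the last round only, and serves as the end marker. *)
Lemma loop_run n w L tA tB t2 t3 h2 h3 :
  (forall x, size (bits (O1 x)) <= L) -> 2 ^ size w = bval w + n.+1 ->
  exists ts, reach ((2 * size w + 2 * L + 10) * n.+1)
    (conf (Copy true) [:: (tA, 0%Z); (tB, 0%Z); (t2, h2); (t3, h3); (ltape w, 0%Z)])
    (conf (Halt (all (fun x => O1 x == O2 x) (iota (bval w) n.+1))) ts).
Proof.
move=> yL; elim: n w tA tB => [|n IHn] w tA tB wn;
  have /= := @round_run w L tA tB t2 t3 h2 h3 (yL _);
  have va := bval_addc true w; have vl := bval_lt (addc true w).1; rewrite size_addc wn in va vl;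
  case: eqP => [_ R|_ [ts R]] /=; try (exists ts; apply: reach_le R _; lia).
  have r2 : (addc true w).2 by move: va; case: (addc true w).2 => //=; lia.
  rewrite r2 in R.
  by eexists; apply: reach_le R _; rewrite muln1.
have r2 : (addc true w).2 = false by move: va; case: (addc true w).2 => //=; lia.
rewrite r2 /= in R va.
have v1 : bval (addc true w).1 = (bval w).+1 by lia.
have [|ts R'] := IHn (addc true w).1 (ltape (bits (O1 (bval w)))) (ltape (bits (O1 (bval w)))).
  by rewrite size_addc v1; lia.
move: R'; rewrite size_addc v1 /= => R'.
by exists ts; apply: (reach_trans R R'); lia.
Qed.

End Run.

(** * Total running time *)

Definition wheel i := iter i inc [::].

Lemma bval_wheel i : bval (wheel i) = i.
Proof. by elim: i => //= i IHi; rewrite bval_inc IHi. Qed.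

Lemma ltn_exp_size_wheel i : i < 2 ^ size (wheel i).
Proof. by rewrite -{1}(bval_wheel i) bval_lt. Qed.

Lemma exp_size_wheel_leq i : 0 < i -> 2 ^ size (wheel i) <= 2 * i.
Proof.
case: i => // i _; elim: i => // i IHi.
rewrite (_ : wheel i.+2 = inc (wheel i.+1)) // /inc size_cat size_addc size_nseq.
have := bval_addc true (wheel i.+1); have := bval_lt (addc true (wheel i.+1)).1.
rewrite size_addc bval_wheel; move: IHi; move: (wheel _) => w IHi; case: (addc _ _).2 => /=.
  by rewrite expnD expn1; lia.
by rewrite addn0; lia.
Qed.

(** The number of cells of [P] used by the first [n] increments, each costing the current length of
    the counter. *)
Definition wheel_dist n := \sum_(i < n) size (wheel i).

Lemma wheel_distS n : wheel_dist n.+1 = wheel_dist n + size (wheel n).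
Proof. by rewrite /wheel_dist big_ord_recr. Qed.

(** Every [i >= 2 ^ L] has length at least [L]. *)
Lemma wheel_dist_lower L n : L * (n - 2 ^ L) <= wheel_dist n.
Proof.
elim: n => [|n IHn]; first by rewrite sub0n muln0.
rewrite wheel_distS; case: (leqP (2 ^ L) n) => nL; last first.
  by rewrite (_ : n.+1 - 2 ^ L = 0) ?muln0 //; lia.
have : L <= size (wheel n).
  rewrite leqNgt; apply/negP => sL; have := ltn_exp_size_wheel n.
  have : 2 ^ size (wheel n) <= 2 ^ L by rewrite leq_exp2l // ltnW.
  lia.
by rewrite subSn // mulnS; lia.
Qed.

Lemma wheel_dist_unbounded a : exists n, a <= wheel_dist n.+1.
Proof. by exists a.+2; have := wheel_dist_lower 1 a.+3; rewrite expn1 mul1n; lia. Qed.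

(** The number of increments completed before the [a] cells of [P] run out. As [wheel_dist n] grows
    like [n log n], this is of order [a / log a]. *)
Definition sweeps a := ex_minn (wheel_dist_unbounded a).

Lemma sweepsP a : a <= wheel_dist (sweeps a).+1 /\ forall m, m < sweeps a -> wheel_dist m.+1 < a.
Proof.
rewrite /sweeps; case: ex_minnP => n an min_n; split=> // m mn.
by rewrite ltnNge; apply/negP => /min_n; lia.
Qed.

Lemma wheel_dist_sweeps a : wheel_dist (sweeps a) <= a.
Proof.
have [_] := sweepsP a; case: (sweeps a) => [|n H]; first by rewrite /wheel_dist big_ord0.
exact/ltnW/H.
Qed.

(** The parameter [L] is free: dividing by a large [L] shows that [sweeps a] is [o(a)]. *)
Lemma sweeps_upper L a : L * sweeps a <= L * 2 ^ L + a.
Proof. have := wheel_dist_lower L (sweeps a); have := wheel_dist_sweeps a; nia. Qed.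

Lemma sweeps_leq a : sweeps a <= a + 2.
Proof. have := sweeps_upper 1 a; lia. Qed.

Lemma wheel_dist_upper c n : 2 * n < 2 ^ c -> wheel_dist n.+1 <= n.+1 * c.
Proof.
move=> nc; rewrite /wheel_dist -[X in X * _]card_ord -sum_nat_const leq_sum // => i _.
case: (posnP i) => [->//|i0]; have := exp_size_wheel_leq i0 => H.
rewrite -(leq_exp2l (m := 2)) //; have := ltn_ord i; lia.
Qed.

(** With [c] about [log a] this is the opposite bound, which makes the counter long enough to beat
    the divisor bound. *)
Lemma sweeps_lower c a : 2 * (a + 2) < 2 ^ c -> a <= (sweeps a).+1 * c.
Proof.
move=> ac; have [H _] := sweepsP a; apply: leq_trans H (wheel_dist_upper _).
have := sweeps_leq a; lia.
Qed.

(* The length of the query counter, for moduli of [a] bits and exponents of [b] bits. *)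
Definition width a b := 128 * (sweeps a).+1 + uphalf b + (3 * uphalf b - a).

(** The summands are the complete sweeps, the last sweep, the rounds on [e], the first rewind and
    the [2 ^ width a b] query rounds. *)
Definition runtime a b :=
  sweeps a * (132 + 2 * a) + (130 + size (wheel (sweeps a))) + (4 * uphalf b).+1 + (a + width a b).+1
    + (2 * width a b + 2 * a + 10) * 2 ^ width a b.

Section Run.
Variables (O1 O2 : nat -> nat).
Local Notation reach := (@reach O1 O2).
Local Notation Zn := Z.of_nat.

Lemma sweeps_run j P E : j <= sweeps (size P) ->
  reach (j * (132 + 2 * size P))
    (conf (Mark ord_max) [:: (ltape [::], 0%Z); (ltape [::], 0%Z); (ltape P, 0%Z); (ltape E, 0%Z); (ltape [::], 0%Z)])
    (conf (Mark ord_max) [:: (ltape (wheel j), 0%Z); (ltape [::], 0%Z); (ltape P, Zn (wheel_dist j)); (ltape E, 0%Z);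
       (ltape (nseq (128 * j) false), Zn (128 * j))]).
Proof.
elim: j => [|j IHj] jP; first by rewrite /wheel_dist big_ord0; apply: reach_refl.
have [_ /(_ j jP)] := sweepsP (size P); rewrite wheel_distS => lt_P.
have := @sweep_cycle O1 O2 (wheel j) (wheel_dist j) (nseq (128 * j) false) P (ltape [::]) (ltape E) 0 0 lt_P.
rewrite -nseqD size_nseq (_ : 128 * j + 128 = 128 * j.+1); last by lia.
move=> R; apply: (reach_trans (IHj (ltnW jP)) R); lia.
Qed.

Lemma machine_halts p e : let a := size (bits p) in
  (forall x, size (bits (O1 x)) <= a) ->
  halts_within machine p e O1 O2 (runtime a (size (bits e)))
    (all (fun x => O1 x == O2 x) (iota 0 (2 ^ width a (size (bits e))))).
Proof.
move=> a O1a; set b := size (bits e); set n := sweeps a.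
have init : init_config machine p e = conf (Mark ord_max)
    [:: (ltape [::], 0%Z); (ltape [::], 0%Z); (ltape (bits p), 0%Z); (ltape (bits e), 0%Z); (ltape [::], 0%Z)].
  have tE i : i < 5 -> tidx machine i = i :> nat by move=> i5; rewrite /tidx inordK.
  apply: eq_conf => // i i5; rewrite -!val_eqE /= !tE //.
  have nilE : (fun _ : Z => None) = ltape [::].
    by apply: functional_extensionality => z; rewrite /ltape andbF.
  by rewrite nilE; case: i i5 => [|[|[|[|[|i]]]]].
have R1 := @sweeps_run n (bits p) (bits e) (leqnn _).
(* The choice of [sweeps] puts the end of [P] within the next increment. *)
have dist_a : wheel_dist n <= size (bits p) <= wheel_dist n + size (wheel n).
  by rewrite -wheel_distS wheel_dist_sweeps; case: (sweepsP a).
have [i [w' [iw]]] := @last_sweep O1 O2 _ _ (nseq (128 * n) false) _ (bits e) dist_a.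
rewrite -nseqD size_nseq (_ : 128 * n + 128 = 128 * n.+1); last by lia.
move=> R2; have R12 := reach_trans R1 R2 (leqnn _).
have half_b : size (bits e) <= 2 * (0 + uphalf b) < (size (bits e)).+2.
  by rewrite add0n -/b; have := odd_double_half b; rewrite uphalf_half; lia.
have R3 := @epair_run O1 O2 _ 0 _ (128 * n.+1) (bits p) (bits e) (ltape w') (ltape [::]) (Zn i - 1)
   (Zn 0 - 1) (leqnn _) half_b.
rewrite muln0 -/(width a b) in R3.
have R123 := reach_trans R12 R3 (leqnn _).
set h := width a b in R123 *.
have R4 := @ret_run O1 O2 (a + h) false w' [::] (nseq h false) i 0 h (ltape (bits p)) (ltape (bits e))
  (Zn (size (bits p) - 3 * uphalf b) - 1)%Z (Zn (2 * (0 + uphalf b))).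
have {}R4 := R4 (leq_trans iw (geq_minl _ _)) (leqnn _) _ _.
rewrite size_nseq in R4; have {}R4 := R4 (leqnn _) ltac:(move: iw; rewrite -/a; lia).
have R1234 := reach_trans R123 R4 (leqnn _).
have bv0 m : bval (nseq m false) = 0 by elim: m => //= m ->.
have := @loop_run O1 O2 (2 ^ h).-1 (nseq h false) a (ltape w') (ltape [::]) (ltape (bits p)) (ltape (bits e))
  (Zn (size (bits p) - 3 * uphalf b) - 1)%Z (Zn (2 * (0 + uphalf b))) O1a.
rewrite size_nseq bv0 add0n prednK ?expn_gt0 // => /(_ erefl)[ts R5].
have [m m_le mE] := reach_trans R1234 R5 (leqnn _).
by exists m; split; [rewrite /runtime -/n -/h | rewrite init mE].
Qed.
End Run.

From mathcomp Require Import all_order all_algebra ring.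
Import Order.POrderTheory Order.TotalTheory GRing.Theory Num.Theory.

(** * The divisor bound *)

Lemma card_le_size (T : finType) (U : eqType) (A : {set T}) (f : T -> U) (s : seq U) :
  {in A &, injective f} -> {in A, forall x, f x \in s} -> #|A| <= size s.
Proof.
move=> f_inj fs; rewrite cardE -(size_map f) uniq_leq_size //.
  by rewrite map_inj_in_uniq ?enum_uniq // => x y; rewrite !mem_enum; apply: f_inj.
by move=> _ /mapP[x xA ->]; apply: fs; rewrite -mem_enum.
Qed.

Lemma card_le_fibers (T : finType) (U : eqType) (A : {set T}) (f : T -> U) (s : seq U) m :
  {in A, forall x, f x \in s} ->
  (forall u, u \in s -> #|[set x in A | f x == u]| <= m) -> #|A| <= size s * m.
Proof.
elim: s A => [|u s IHs] A fs fm.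
  by rewrite leqn0 cards_eq0 -subset0; apply/subsetP => x /fs.
rewrite -(cardsID [set x | f x == u] A) mulSn leq_add //.
  by apply: leq_trans (fm u (mem_head _ _)); rewrite subset_leq_card //;
     apply/subsetP => x; rewrite !inE.
apply: IHs => [x|v vs].
  by rewrite !inE => /andP[nxu /fs]; rewrite inE (negbTE nxu).
apply: leq_trans (fm v _); last by rewrite inE vs orbT.
by apply/subset_leq_card/subsetP => x; rewrite !inE => /andP[/andP[_ ->] ->].
Qed.

(** A divisor [d] is the product of [gcdn d m] and [d %/ gcdn d m]. The latter is coprime to
    [m %/ gcdn d m], so it divides [n] by Gauss. *)
Lemma size_divisors_mul m n : 0 < m -> 0 < n ->
  size (divisors (m * n)) <= size (divisors m) * size (divisors n).
Proof.
move=> m0 n0.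
set F := fun d => (gcdn d m, d %/ gcdn d m).
rewrite -(size_allpairs pair) -(size_map F) uniq_leq_size //.
  rewrite map_inj_in_uniq ?divisors_uniq // => x y _ _ [e1]; rewrite e1 => e2.
  by rewrite -(divnK (dvdn_gcdl x m)) -[RHS](divnK (dvdn_gcdl y m)) e1 e2.
move=> _ /mapP[d dmn ->]; rewrite -dvdn_divisors ?muln_gt0 ?m0 // in dmn.
apply/allpairsP; exists (F d); split=> //=; rewrite -dvdn_divisors ?dvdn_gcdr //.
have g0 : 0 < gcdn d m by rewrite gcdn_gt0 m0 orbT.
have cop : coprime (d %/ gcdn d m) (m %/ gcdn d m).
  by rewrite /coprime -(eqn_pmul2r g0) muln_gcdl !divnK ?dvdn_gcdl ?dvdn_gcdr // mul1n.
rewrite -(Gauss_dvdr _ cop) -(dvdn_pmul2r g0) divnK ?dvdn_gcdl //.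
by rewrite mulnAC divnK ?dvdn_gcdr.
Qed.

Lemma size_divisors_pfactor q k : prime q -> size (divisors (q ^ k)) <= k.+1.
Proof.
move=> q_pr; rewrite -[X in _ <= X](size_iota 0) -(size_map (expn q) (iota _ _)) uniq_leq_size ?divisors_uniq //.
move=> d; rewrite -dvdn_divisors ?expn_gt0 ?prime_gt0 // => /(dvdn_pfactor _ _ q_pr)[i ik ->].
by apply: map_f; rewrite mem_iota.
Qed.

(** Bound [a.+1 ^ k] by the falling factorial of [a + k], which is [k!] times a binomial coefficient
    at most [2 ^ (a + k)]. *)
Lemma leq_expS_fact a k : a.+1 ^ k <= k`! * 2 ^ (a + k).
Proof.
have H : a.+1 ^ k <= (a + k) ^_ k.
  elim: k => [|k IHk]; first by rewrite ffactn0.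
  by rewrite addnS ffactnS /= expnS leq_mul // ltnS leq_addr.
apply: leq_trans H _; rewrite -bin_ffact mulnC leq_mul2l; apply/orP; right.
have := Pascal 1 1 (a + k).
rewrite (_ : 1 + 1 = 2) // => ->.
by rewrite (bigD1 (inord k)) //= !exp1n !muln1 inordK ?leq_addr // ltnS leq_addl.
Qed.

Lemma fact_leq_expn n : n`! <= n ^ n.
Proof.
elim: n => // n IHn; rewrite factS expnS leq_mul2l; apply/orP; right.
by apply: leq_trans IHn _; case: n => // n; rewrite leq_exp2r.
Qed.

(** For [q >= 2 ^ k], [a.+1 <= 2 ^ a] already gives [q ^ a]. For smaller [q], the factor
    [k! * 2 ^ k] left by [leq_expS_fact] is at most [2 ^ (k * k.+1) <= 2 ^ (4 ^ k)]. *)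
Lemma pfactor_bound q a k : prime q ->
  a.+1 ^ k <= (if q < 2 ^ k then 2 ^ (4 ^ k) else 1) * q ^ a.
Proof.
move=> q_pr; have q2 := prime_gt1 q_pr; case: ltnP => qk.
  apply: leq_trans (leq_expS_fact a k) _.
  have h2 : 2 ^ a <= q ^ a by case: (a) => // b; rewrite leq_exp2r.
  rewrite addnC expnD mulnA leq_mul //.
  have hk : k`! <= 2 ^ (k * k).
    apply: leq_trans (fact_leq_expn k) _; rewrite expnM.
    by case: (k) => // j; rewrite leq_exp2r // ltnW // ltn_expl.
  apply: leq_trans (leq_mul hk (leqnn _)) _; rewrite -expnD leq_exp2l //.
  rewrite -mulSnr mulnC (_ : 4 = 2 * 2) // expnMn leq_mul //; last by rewrite ltn_expl.
  by rewrite ltnW // ltn_expl.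
rewrite mul1n; apply: leq_trans (_ : (2 ^ k) ^ a <= _); last first.
  by case: (a) => // b; rewrite leq_exp2r.
rewrite expnAC; case: (k) => // j; rewrite leq_exp2r //.
exact: ltn_expl.
Qed.

(** Strong induction, splitting off the full power of the least prime factor; only primes below
    [2 ^ k] cost a constant. *)
Lemma divisor_bound_primes k n : 0 < n ->
  size (divisors n) ^ k <= (2 ^ (4 ^ k)) ^ count (fun q => q < 2 ^ k) (primes n) * n.
Proof.
have [m] := ubnP n; elim: m n => // m IHm n; rewrite ltnS => nm n0.
have [n1|n1] := leqP n 1.
  by have -> : n = 1 by [lia]; rewrite [size _]/= exp1n muln_gt0 expn_gt0 expn_gt0.
have q_pr := pdiv_prime n1; set q := pdiv n in q_pr.
have nq : q \in primes n by rewrite mem_primes q_pr n0 pdiv_dvd.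
have [u cqu nE] := pfactor_coprime q_pr n0.
set a := logn q n in nE.
have a0 : 0 < a by rewrite logn_gt0.
have u0 : 0 < u by rewrite lt0n; apply: contraTneq n0 => u00; rewrite nE u00 mul0n.
have un : u < n.
  by rewrite nE ltn_Pmulr // -(exp1n a) ltn_exp2r ?prime_gt1.
have Hu := IHm u (leq_trans un nm) u0.
have Hp := pfactor_bound a k q_pr.
have tau_le : size (divisors n) <= size (divisors u) * a.+1.
  rewrite nE; apply: leq_trans (size_divisors_mul u0 _) _; first by rewrite expn_gt0 prime_gt0.
  by rewrite leq_mul2l size_divisors_pfactor ?orbT.
have pE : perm_eq (primes n) (q :: primes u).
  apply: uniq_perm; rewrite ?primes_uniq //=.
    rewrite primes_uniq andbT mem_primes q_pr u0 /=.
    by move: cqu; rewrite prime_coprime.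
  move=> r; rewrite inE [n in primes n]nE primesM ?u0 ?expn_gt0 ?(prime_gt0 q_pr) // orbC.
  by rewrite primesX // (primes_prime q_pr) inE.
move/permP: pE => /(_ (fun q => q < 2 ^ k)) /= ->.
rewrite expnD.
apply: leq_trans (_ : (size (divisors u) * a.+1) ^ k <= _).
  by case: (k) => // j; rewrite leq_exp2r.
rewrite expnMn mulnC [X in _ <= _ * X]nE.
apply: leq_trans (leq_mul Hp Hu) _.
have -> : (if q < 2 ^ k then 2 ^ 4 ^ k else 1) = (2 ^ (4 ^ k)) ^ (q < 2 ^ k) by case: ifP.
by rewrite mulnACA [q ^ a * u]mulnC.
Qed.

(** At most [2 ^ k] primes lie below [2 ^ k], each costing [2 ^ (4 ^ k)]. *)
Lemma divisor_bound k n : 0 < n -> size (divisors n) ^ k <= 2 ^ (8 ^ k) * n.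
Proof.
move=> n0; apply: leq_trans (divisor_bound_primes k n0) _.
rewrite leq_mul2r; apply/orP; right; rewrite -expnM leq_exp2l //.
rewrite (_ : 8 = 4 * 2) // expnMn leq_mul2l; apply/orP; right.
rewrite -size_filter -[X in _ <= X](size_iota 0).
apply: uniq_leq_size; first by rewrite filter_uniq ?primes_uniq.
by move=> r; rewrite mem_filter mem_iota => /andP[].
Qed.

(** * Points on modular hyperbolas *)


(** Pigeonhole: two of the [T0 + 1] residues [j * c %% p] share one of [T0] intervals of length
    [p / T0]; [T] is the difference of their indices and [u] that of the residues. *)
Lemma dirichlet_mod (p c T0 : nat) : 0 < p -> 0 < T0 ->
  exists (T : nat) (u z : int), [/\ 0 < T <= T0, ((T * c)%N%:Z = u + z * p%:Z)%R & T0 * `|u| <= p].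
Proof.
move=> p0 T0gt.
have bucket_lt (j : 'I_T0.+1) : ((j * c) %% p * T0) %/ p < T0.
  by rewrite ltn_divLR // mulnC ltn_pmul2l // ltn_mod.
pose f (j : 'I_T0.+1) := Ordinal (bucket_lt j).
have /injectivePn[i0 [j0 ij0 fij0]] : ~~ injectiveb f.
  by apply/negP => /injectiveP/leq_card; rewrite !card_ord ltnn.
have {ij0 fij0} [i [j [ij /(congr1 val) /= fij]]] : exists i j : 'I_T0.+1, i < j /\ f i = f j.
  case: (ltngtP i0 j0) => [ij|ji|/val_inj e]; [by exists i0, j0|by exists j0, i0|].
  by rewrite e eqxx in ij0.
exists (j - i), (((j * c) %% p)%N%:Z - ((i * c) %% p)%N%:Z)%R, (((j * c) %/ p)%N%:Z - ((i * c) %/ p)%N%:Z)%R.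
have [Ei Ej] := (divn_eq (i * c) p, divn_eq (j * c) p).
move: (ltn_ord j) (ltn_pmod (i * c) p0) (ltn_pmod (j * c) p0).
set ri := (i * c) %% p in Ei fij *; set rj := (j * c) %% p in Ej fij *.
set qi := (i * c) %/ p in Ei *; set qj := (j * c) %/ p in Ej *.
move=> jT ltri ltrj.
have [Fi Fj] := (divn_eq (ri * T0) p, divn_eq (rj * T0) p).
have := ltn_pmod (ri * T0) p0; have := ltn_pmod (rj * T0) p0.
rewrite -fij in Fj; move: (_ %% _) (_ %% _) (_ %/ _) Fi Fj => mi mj d Fi Fj ltj lti.
split; first lia.
- have ic_jc : i * c <= j * c by rewrite leq_mul2r (ltnW ij) orbT.
  rewrite mulnBl -subzn // Ej Ei !PoszD !PoszM; ring.
- have dE : (T0%:Z * (rj%:Z - ri%:Z) = mi%:Z - mj%:Z)%R by lia.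
  by rewrite -[T0 in T0 * _]/(`|Posz T0|) -abszM dE; lia.
Qed.

Section Hyperbola.
Variables (p H c m T0 B : nat).
Hypotheses (p_pr : prime p) (T0p : T0 < p) (T0H : p <= T0 ^ 2 * H <= 4 * p) (ndvd_m : ~~ (p %| m)).
Hypothesis tauB : forall N, 0 < N <= 25 * p ^ 2 -> size (divisors N) <= B.

(* With [T c = u] mod p and [T], [u] small, [K = T x y + u (x + y)] is determined mod p on the
   hyperbola, hence takes few integer values, and [(T x + u) (T y + u) = T K + u ^ 2]. *)
Lemma card_modular_hyperbola :
  #|[set xy : 'I_H * 'I_H | (xy.1 + c) * (xy.2 + c) == m %[mod p]]|
    <= ((8 * H + T0) %/ T0) * (2 * B).
Proof.
have p0 := prime_gt0 p_pr.
have T0gt : 0 < T0 by lia.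
have [T [u [z [/andP[Tgt leT] Tc uT0]]]] := dirichlet_mod c p0 T0gt.
set A := [set _ | _].
pose K (x y : nat) : int := (T%:Z * x%:Z * y%:Z + u * (x%:Z + y%:Z))%R.
(* [K] can be negative, as [u] can; the shifted [kap] is a natural number, to be divided by [p]. *)
pose off := 2 * H * `|u|.
pose kap x y := `|(K x y + off%:Z)%R|.
have uxy_le (x y : 'I_H) : (- off%:Z <= u * (x%:Z + y%:Z) <= off%:Z)%R.
  rewrite -ler_norml normrM [X in (_ * X)%R]ger0_norm // -abszE -PoszD -PoszM lez_nat.
  rewrite /off mulnC leq_mul2r.
  by have := ltn_ord x; have := ltn_ord y; lia.
have Txy_le (x y : 'I_H) : T * x * y <= T0 * H ^ 2.
  by rewrite -mulnA leq_mul // expnS expn1 leq_mul // ltnW.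
have K_ge (xy : 'I_H * 'I_H) : (0 <= K xy.1 xy.2 + off%:Z)%R.
  by have := uxy_le xy.1 xy.2; rewrite /K; lia.
have kapE (xy : 'I_H * 'I_H) : ((kap xy.1 xy.2)%:Z = K xy.1 xy.2 + off%:Z)%R.
  by rewrite /kap gez0_abs.
have kap_le (xy : 'I_H * 'I_H) : kap xy.1 xy.2 <= T0 * H ^ 2 + 4 * H * `|u|.
  rewrite -lez_nat kapE; have := uxy_le xy.1 xy.2; have := Txy_le xy.1 xy.2.
  by rewrite /K /off; lia.
have inA (xy : 'I_H * 'I_H) : xy \in A ->
    exists w : int, ((xy.1 + c)%N%:Z * (xy.2 + c)%N%:Z = m%:Z + w * p%:Z)%R.
  rewrite inE => /eqP E.
  exists (((xy.1 + c) * (xy.2 + c) %/ p)%N%:Z - (m %/ p)%N%:Z)%R.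
  have := divn_eq ((xy.1 + c) * (xy.2 + c)) p; have := divn_eq m p; rewrite E.
  rewrite -PoszM; move: (_ * _) => a; lia.
(* [T (x + c) (y + c) = T x y + T c (x + y) + T c ^ 2], and [T c = u] modulo [p], so [K] is
   [T (m - c ^ 2)] modulo [p]. *)
have kap_mod (xy : 'I_H * 'I_H) : xy \in A -> exists v : int,
    ((kap xy.1 xy.2)%:Z = T%:Z * (m%:Z - c%:Z ^+ 2) + off%:Z + v * p%:Z)%R.
  move=> /inA[w wE]; exists (T%:Z * w - z * (xy.1%:Z + xy.2%:Z))%R.
  rewrite kapE /K.
  have -> : u = (T%:Z * c%:Z - z * p%:Z)%R by rewrite -PoszM Tc; ring.
  move: wE; rewrite !PoszD => wE.
  have -> : (m%:Z = (xy.1%:Z + c%:Z) * (xy.2%:Z + c%:Z) - w * p%:Z)%R by rewrite wE; ring.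
  ring.
have K_inj xy xy' : xy \in A -> xy' \in A ->
    kap xy.1 xy.2 %/ p = kap xy'.1 xy'.2 %/ p -> K xy.1 xy.2 = K xy'.1 xy'.2.
  move=> Axy Axy' E.
  suff : kap xy.1 xy.2 = kap xy'.1 xy'.2 by move=> /(congr1 Posz); rewrite !kapE => /addIr.
  have [v vE] := kap_mod _ Axy; have [v' vE'] := kap_mod _ Axy'.
  have := divn_eq (kap xy.1 xy.2) p; have := divn_eq (kap xy'.1 xy'.2) p; rewrite E.
  have := ltn_pmod (kap xy.1 xy.2) p0; have := ltn_pmod (kap xy'.1 xy'.2) p0.
  move: vE vE'; move: (kap xy.1 _) (kap xy'.1 _) (_ %/ _) (kap xy.1 _ %% _) (kap xy'.1 _ %% _) => k k' d r r' vE vE' lr lr' kE kE'.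
  have : (k%:Z - k'%:Z = (v - v') * p%:Z)%R by rewrite vE vE'; ring.
  move: (v - v')%R => t kt.
  have {}kt : (r%:Z - r'%:Z = t * p%:Z)%R by rewrite -kt kE kE'; lia.
  have tp : `|t| * p < p by have <- : `|(t * p%:Z)%R| = `|t| * p by [rewrite abszM]; rewrite -kt; lia.
  have t0 : t = 0 by apply/eqP; rewrite -absz_eq0 -leqn0 -ltnS -(ltn_pmul2r p0) mul1n.
  by move: kt; rewrite t0 mul0r; lia.
(* Modulo [p], [T x + u] is [T (x + c)]; [p] divides neither [T], as [0 < T < p], nor [x + c], as
   [m] is nonzero. *)
have nz (xy : 'I_H * 'I_H) : xy \in A ->
    (T%:Z * xy.1%:Z + u != 0)%R /\ (T%:Z * xy.2%:Z + u != 0)%R.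
  have key a : (T%:Z * a%:Z + u = 0)%R -> p %| a + c.
    move=> E; have : ((T * (a + c))%N%:Z = z * p%:Z)%R by rewrite mulnDr PoszD Tc PoszM; lia.
    move=> /(congr1 absz); rewrite abszM !absz_nat => E'.
    have : p %| T * (a + c) by rewrite E' dvdn_mull.
    by rewrite Gauss_dvdr // prime_coprime // gtnNdvd //; lia.
  have ndvd x y : (x + c) * (y + c) = m %[mod p] -> ~~ (p %| x + c) && ~~ (p %| y + c).
    move=> E; rewrite -negb_or -Euclid_dvdM //; apply: contra ndvd_m.
    by rewrite /dvdn E.
  rewrite inE => /eqP/ndvd/andP[nd1 nd2]; split; apply/eqP => /key; exact/negP.
(* [T0 * kap <= T0 ^ 2 H ^ 2 + 4 H T0 |u| <= 8 H p], so the quotient of [kap] by [p] is at most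
   [8 H / T0]; the added [T0] counts the quotient 0. *)
pose kaps := iota 0 ((8 * H + T0) %/ T0).
pose F (xy : 'I_H * 'I_H) := kap xy.1 xy.2 %/ p.
rewrite -[X in X * _ ](size_iota 0).
apply: (card_le_fibers (f := F)) => [xy Axy|k _].
  rewrite mem_iota /= add0n leq_divRL //.
  have := kap_le xy; have := leq_trunc_div (kap xy.1 xy.2) p; rewrite -/(F xy) => l1 l2.
  have h1 : T0 * (F xy * p) <= T0 * (T0 * H ^ 2 + 4 * H * `|u|).
    by rewrite leq_mul2l (leq_trans l1 l2) orbT.
  have h2 : (T0 ^ 2 * H) * H <= 4 * p * H by case/andP: T0H => _ h; rewrite leq_mul2r h orbT.
  have h3 : 4 * H * (T0 * `|u|) <= 4 * H * p by rewrite leq_mul2l uT0 orbT.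
  rewrite -(leq_pmul2r p0); lia.
have [->|[[x0 y0]]] := set_0Vmem [set x in A | F x == k]; first by rewrite cards0.
rewrite inE => /andP[A0 /eqP F0].
pose N := ((T%:Z * x0%:Z + u) * (T%:Z * y0%:Z + u))%R.
have NE : N = (T%:Z * K x0 y0 + u ^+ 2)%R by rewrite /N /K; ring.
have /= [nz1 nz2] := nz _ A0.
have N0 : N != 0%R by rewrite mulf_neq0.
(* [T x <= T0 H <= T0 ^ 2 H <= 4 p] and [|u| <= p]. *)
have N_mod : `|N| <= 25 * p ^ 2.
  have factor_le x : x < H -> `|(T%:Z * x%:Z + u)%R| <= 5 * p.
    move=> xH; have Tx : T * x <= 4 * p.
      case/andP: T0H => _; apply: leq_trans.
      rewrite (leq_trans (leq_mul leT (ltnW xH))) // leq_mul2r -mulnn.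
      by rewrite leq_pmulr ?orbT.
    have : `|u| <= p by apply: leq_trans uT0; rewrite leq_pmull.
    lia.
  rewrite abszM (_ : 25 * p ^ 2 = (5 * p) * (5 * p)); last by rewrite -!mulnn mulnACA.
  by rewrite leq_mul ?factor_le.
have tauN : size (divisors `|N|) <= B by rewrite tauB // absz_gt0 N0.
(* Factors may have either sign, which accounts for [2 * B]. *)
pose divs := [seq Posz d | d <- divisors `|N|] ++ [seq (- Posz d)%R | d <- divisors `|N|].
apply: (@leq_trans (size divs)); last by rewrite size_cat !size_map; lia.
have inN (xy : 'I_H * 'I_H) : xy \in [set x in A | F x == k] ->
    [/\ xy \in A, N = ((T%:Z * xy.1%:Z + u) * (T%:Z * xy.2%:Z + u))%R
      & (T%:Z * xy.1%:Z + u != 0)%R].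
  rewrite inE => /andP[Axy /eqP Fxy]; split=> //; last by case: (nz _ Axy).
  have := K_inj _ _ A0 Axy; rewrite -!/(F _) F0 Fxy NE => /(_ erefl) ->.
  by rewrite /K; ring.
(* The factor [T x + u] determines [x], and the quotient of [N] by it determines [y]. *)
apply: (card_le_size (f := fun xy : 'I_H * 'I_H => (T%:Z * xy.1%:Z + u)%R)).
  move=> xy xy' /inN[Axy Nxy nxy] /inN[Axy' Nxy' nxy'] /= E.
  have T_inj (x y : 'I_H) : (T%:Z * x%:Z + u = T%:Z * y%:Z + u)%R -> x = y.
    move=> /addIr/mulfI e; apply: val_inj; have : Posz x = Posz y by apply: e; lia.
    by case.
  have e1 := T_inj _ _ E.
  have e2 : xy.2 = xy'.2.
    by apply: T_inj; apply: (mulfI nxy); rewrite -Nxy Nxy' -E.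
  by case: (xy) (xy') e1 e2 => [? ?] [? ?] /= -> ->.
move=> xy /inN[Axy Nxy nxy]; rewrite mem_cat.
have : `|(T%:Z * xy.1%:Z + u)%R| \in divisors `|N|.
  by rewrite -dvdn_divisors ?absz_gt0 // Nxy abszM dvdn_mulr.
move: (_ + _)%R => d dN.
have [d0|d0] := leP 0%R d.
  by apply/orP; left; apply/mapP; exists `|d| => //; rewrite gez0_abs.
by apply/orP; right; apply/mapP; exists `|d| => //; rewrite ltz0_abs ?opprK.
Qed.
End Hyperbola.

(** * Separating two shifts *)


Lemma Fp_nat_eq p (p_pr : prime p) (a b : nat) :
  (a%:R = b%:R :> 'F_p)%R <-> a = b %[mod p].
Proof.
split=> [/(congr1 val)/=|E]; last by rewrite -(Fp_nat_mod p_pr a) E Fp_nat_mod.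
by rewrite !val_Fp_nat.
Qed.

(** For the least [T] with [p <= T ^ 2 * H], [H < p] gives [T >= 2], so [T <= 2 (T - 1)] and
    minimality yields the factor 4. *)
Lemma dirichlet_scale p H : 1 < p -> 1 < H < p ->
  exists T, [/\ 0 < T < p & p <= T ^ 2 * H <= 4 * p].
Proof.
move=> p1 /andP[H1 Hp].
have ex : exists T, p <= T ^ 2 * H by exists p; rewrite -mulnn; nia.
have [T pT minT] := ex_minnP ex.
have T2 : 1 < T by rewrite ltnNge; apply/negP => ?; have : T ^ 2 <= 1 by [rewrite -mulnn; nia]; nia.
have : T.-1 ^ 2 * H < p by rewrite ltnNge; apply/negP => /minT; lia.
case: T T2 pT minT => // T; rewrite ltnS /= -!mulnn => T1 pT _ Tp.
by exists T.+1; rewrite -!mulnn; split; [nia|apply/andP; split; nia].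
Qed.

Section Separation.
Variables (p e s t H B : nat).
Hypotheses (p_pr : prime p) (e0 : 0 < e) (sp : s < p) (tp : t < p) (st : s != t).
Hypothesis (H1 : 1 < H).
Hypothesis tauB : forall N, 0 < N <= 25 * p ^ 2 -> size (divisors N) <= B.
Hypothesis eqH : forall x, x < H -> oracle p e s x = oracle p e t x.

Let S : 'F_p := s%:R%R.
Let T : 'F_p := t%:R%R.

Lemma st_neq0 : (S - T != 0)%R.
Proof.
rewrite subr_eq0; apply: contra st => /eqP/(Fp_nat_eq p_pr).
by rewrite !modn_small // => ->.
Qed.

Lemma oracle_eqF x : x < H -> ((x%:R + S) ^+ e = (x%:R + T) ^+ e)%R.
Proof. by move=> /eqH; rewrite /oracle => /(Fp_nat_eq p_pr); rewrite !natrX !natrD. Qed.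

(** A zero of [x + T] makes both oracle answers 0, hence is also a zero of [x + S], which forces
    [S = T]. *)
Lemma shift_neq0 x : x < H -> (x%:R + T != 0)%R.
Proof.
move=> /oracle_eqF E; apply: contraNneq st_neq0 => xT.
have xS : (x%:R + S = 0)%R.
  by apply/eqP; move/eqP: E; rewrite xT expr0n gtn_eqF //= expf_eq0 e0.
by rewrite subr_eq0; apply/eqP/(addrI x%:R%R); rewrite xS xT.
Qed.

Lemma range_lt : H <= p.
Proof.
rewrite leqNgt; apply/negP => pH.
have := @shift_neq0 (p - t); rewrite -natrD subnK ?(ltnW tp) // => /(_ _)/negP[]; first by lia.
by rewrite -[p in X in (X%:R)%R]mul1n natrM (pchar_Fp_0 p_pr) mulr0.
Qed.

Let lam (xy : 'I_H * 'I_H) : 'F_p :=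
  ((xy.1%:R + S) * (xy.2%:R + S) / ((xy.1%:R + T) * (xy.2%:R + T)))%R.

Lemma lamE (xy : 'I_H * 'I_H) : ((xy.1%:R + S) * (xy.2%:R + S) = lam xy * ((xy.1%:R + T) * (xy.2%:R + T)))%R.
Proof. by rewrite divfK // mulf_neq0 // shift_neq0. Qed.

Lemma lam_exp xy : (lam xy ^+ e = 1)%R.
Proof.
rewrite expr_div_n !exprMn !oracle_eqF // divff // -exprMn expf_neq0 //.
by rewrite mulf_neq0 // shift_neq0.
Qed.

(** [lam xy = 1] means [(S - T) (x + y + S + T) = 0], so [x] determines [y] modulo [p], and
    [H <= p]. *)
Lemma card_lam1 : #|[set xy | lam xy == 1%R]| <= H.
Proof.
rewrite -[X in _ <= X]size_enum_ord; apply: (card_le_size (f := fst)); last first.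
  by move=> xy _; rewrite mem_enum.
have sum0 xy : lam xy == 1%R -> (xy.2%:R = - (S + T + xy.1%:R) :> 'F_p)%R.
  move=> /eqP l1; have := lamE xy; rewrite l1 mul1r => E; apply/eqP; rewrite -subr_eq0 opprK.
  suff : ((S - T) * (xy.2%:R + (S + T + xy.1%:R)) == 0)%R.
    by rewrite mulf_eq0 (negbTE st_neq0).
  rewrite [X in (X == _)%R](_ : _ = (xy.1%:R + S) * (xy.2%:R + S)
     - (xy.1%:R + T) * (xy.2%:R + T))%R; last by ring.
  by rewrite E subrr.
move=> [x y] [x' y']; rewrite !inE => /sum0 /= E /sum0 /= E' xx'; rewrite -xx' -E in E'.
move/(Fp_nat_eq p_pr): E'; have := range_lt; have := ltn_ord y; have := ltn_ord y' => ? ? ?.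
rewrite !modn_small; [|lia..] => yy'.
by rewrite xx'; congr pair; apply: val_inj.
Qed.

Lemma all_equal_bound : p * H <= 2 ^ 12 * e ^ 2 * B ^ 2 \/ H ^ 2 <= 8 * e * B.
Proof.
(* [range_lt] leaves the case [H = p], where the residue of [p - t] is a zero of [x + T] in
   range. *)
have Hp : 1 < H < p.
  rewrite H1 ltn_neqAle range_lt andbT; apply/negP => /eqP Hp.
  have := @shift_neq0 ((p - t) %% p); rewrite Hp ltn_mod prime_gt0 // => /(_ erefl).
  rewrite Fp_nat_mod // -natrD subnK ?(ltnW tp) // -[p in X in (X%:R)%R]mul1n natrM.
  by rewrite (pchar_Fp_0 p_pr) mulr0 eqxx.
have [T0 [/andP[T00 T0p] T0H]] := dirichlet_scale (prime_gt1 p_pr) Hp.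
set q := (8 * H + T0) %/ T0.
have main : H * H <= H + e * (q * (2 * B)).
  have {1 2}-> : H = #|'I_H| by rewrite card_ord.
  rewrite -card_prod -cardsT -(cardsID [set xy | lam xy == 1%R]) setTI leq_add ?card_lam1 //.
  pose roots := [seq x <- enum 'F_p | (x ^+ e == 1)%R && (x != 1%R)].
  apply: (@leq_trans (size roots * (q * (2 * B)))); last first.
    rewrite leq_mul2r; apply/orP; right; apply: max_unity_roots e0 _ _.
      by apply/allP => x; rewrite mem_filter unity_rootE => /andP[/andP[]].
    by rewrite filter_uniq ?enum_uniq.
  apply: (card_le_fibers (f := lam)) => [xy|l].
    by rewrite !inE andbT mem_filter mem_enum lam_exp eqxx => ->.
  rewrite mem_filter => /andP[/andP[le l1] _].
  have l1' : (1 - l != 0)%R by rewrite subr_eq0 eq_sym.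
  have l0 : (l != 0)%R.
    by apply: contraTneq le => ->; rewrite expr0n gtn_eqF //= eq_sym oner_eq0.
  (* Dividing [(x + S) (y + S) = l (x + T) (y + T)] by [1 - l] and completing the product gives
     [(x + c) (y + c) = m]. *)
  pose c : 'F_p := ((S - l * T) / (1 - l))%R.
  pose m : 'F_p := (l * (S - T) ^+ 2 / (1 - l) ^+ 2)%R.
  have natF (x : 'F_p) : ((x : nat)%:R = x)%R by apply: natr_Zp.
  have ndvd : ~~ (p %| m).
    apply/negP => /eqP pm; have /(Fp_nat_eq p_pr) : (m : nat) = 0 %[mod p] by rewrite pm mod0n.
    by rewrite natF => /eqP; apply/negP; rewrite !mulf_neq0 ?invr_eq0 ?expf_neq0 ?st_neq0.
  apply: leq_trans (card_modular_hyperbola c p_pr T0p T0H ndvd tauB).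
  apply/subset_leq_card/subsetP => xy; rewrite !inE => /andP[_ /eqP lxy].
  apply/eqP/(Fp_nat_eq p_pr); rewrite natrM !natrD !natF.
  have := lamE xy; rewrite lxy => E.
  apply/eqP; rewrite -subr_eq0.
  have -> : ((xy.1%:R + c) * (xy.2%:R + c) - m =
     ((xy.1%:R + S) * (xy.2%:R + S) - l * ((xy.1%:R + T) * (xy.2%:R + T))) / (1 - l))%R.
    by rewrite /c /m; field.
  by rewrite E subrr mul0r.
have qT0 : q * T0 <= 8 * H + T0 by apply: leq_trunc_div.
clearbody q; case: (leqP T0 (8 * H)) => T0le; last first.
  have q1 : q <= 1 by nia.
  right; rewrite -mulnn.
  have : q * (e * (2 * B)) <= e * (2 * B) by rewrite -[X in _ <= X]mul1n leq_mul2r q1 orbT.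
  nia.
left.
have h1 : T0 * (H * H) <= T0 * H + e * (2 * B) * (16 * H).
  apply: leq_trans (_ : T0 * (H + e * (q * (2 * B))) <= _); first by rewrite leq_mul2l main orbT.
  have : e * (2 * B) * (q * T0) <= e * (2 * B) * (16 * H) by rewrite leq_mul2l; apply/orP; right; lia.
  nia.
(* Cancelling [H] leaves [T0 H <= T0 + 32 e B], and [T0] is at most half of [T0 H] as [H >= 2].
   Squaring 64 gives the [2 ^ 12] of the conclusion. *)
have h2 : T0 * H <= 64 * e * B.
  have : (T0 * H) * H <= (T0 + 32 * (e * B)) * H by nia.
  by rewrite leq_pmul2r; nia.
have h3 : (T0 * H) ^ 2 <= (64 * e * B) ^ 2 by rewrite leq_exp2r.
apply: leq_trans (_ : (T0 ^ 2 * H) * H <= _); first by case/andP: T0H => h _; rewrite leq_mul2r h orbT.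
by move: h3; rewrite -!mulnn; nia.
Qed.
End Separation.

Lemma oracle_separation p e s t H B :
  prime p -> 0 < e -> s < p -> t < p -> s != t -> 1 < H ->
  (forall N, 0 < N <= 25 * p ^ 2 -> size (divisors N) <= B) ->
  2 ^ 12 * e ^ 2 * B ^ 2 < p * H -> 8 * e * B < H ^ 2 ->
  exists2 x, x < H & oracle p e s x != oracle p e t x.
Proof.
move=> p_pr e0 sp tp st H1 tauB big1 big2.
have [/existsP[x nx]|/existsPn none] := boolP [exists x : 'I_H, oracle p e s x != oracle p e t x].
  by exists x.
have eqH x : x < H -> oracle p e s x = oracle p e t x.
  by move=> xH; have := none (Ordinal xH) => /negPn/eqP.
by have [] := all_equal_bound p_pr e0 sp tp st H1 tauB eqH; rewrite leqNgt ?big1 ?big2.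
Qed.

(** Take [k] about [log_8 a] in [divisor_bound]: then [8 ^ k <= a], and [sweeps_lower] with
    [c = 3 k + 5 <= 8 k] gives [a <= 8 k (sweeps a).+1]. The 7 is saved for the constants of
    [oracle_separation], and [25 p ^ 2 < 2 ^ (2 a + 5)] for [p < 2 ^ a]. *)
Lemma divisor_bound_sweeps a N : 1 < a -> 0 < N -> N < 2 ^ (2 * a + 5) ->
  size (divisors N) <= 2 ^ (64 * (sweeps a).+1 - 7).
Proof.
move=> a1 N0 N_lt.
have [k [k0 ka]] : exists k, 0 < k /\ 8 ^ k + 2 * a + 5 <= k * (64 * (sweeps a).+1 - 7).
  case: (leqP 8 a) => a8; last by exists 1; lia.
  exists (trunc_log 8 a); have a0 : 0 < a by lia.
  have := trunc_logP (isT : 1 < 8) a0; have := trunc_log_ltn a (isT : 1 < 8).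
  have : 0 < trunc_log 8 a by rewrite trunc_log_gt0.
  set k := trunc_log 8 a => k0 ak ka; split=> //.
  have := @sweeps_lower (3 * k + 5) a.
  have -> : 2 ^ (3 * k + 5) = 4 * 8 ^ k.+1 by rewrite expnD expnM (expnS 8 k) -[2 ^ 3]/8 -[2 ^ 5]/32; lia.
  have -> : 2 * (a + 2) < 4 * 8 ^ k.+1 by lia.
  move=> /(_ isT) an; have kk : k < 8 ^ k by apply: ltn_expl.
  have : (sweeps a).+1 * (3 * k + 5) <= (sweeps a).+1 * (8 * k) by rewrite leq_mul2l; lia.
  by nia.
rewrite -(leq_exp2r _ _ k0) -expnM; apply: leq_trans (divisor_bound k N0) _.
apply: (@leq_trans (2 ^ (8 ^ k + (2 * a + 5)))); first by rewrite expnD leq_mul2l ltnW ?orbT.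
by rewrite leq_exp2l // mulnC; lia.
Qed.

(** * The counter is long enough, and the running time short enough *)

Lemma uphalf_bounds b : b <= 2 * uphalf b <= b + 1.
Proof. by have := odd_double_half b; rewrite uphalf_half; lia. Qed.

Lemma agreement_decides p e s t : prime p -> 0 < e -> s < p -> t < p ->
  all (fun x => oracle p e s x == oracle p e t x)
    (iota 0 (2 ^ width (size (bits p)) (size (bits e)))) = (s == t).
Proof.
move=> p_pr e0 sp tp; have [->|st] := eqVneq s t; first by apply/allP => x _.
apply/negbTE/allPn.
set a := size (bits p); set b := size (bits e); set h := width a b; set n := sweeps a.
have p0 := prime_gt0 p_pr.
have a_le : 2 ^ a.-1 <= p by apply: size_bits_exp_leq.
have p_lt : p < 2 ^ a by apply: ltn_exp_size_bits.
have a1 : 1 < a.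
  rewrite ltnNge; apply/negP => a1; have : 2 ^ a <= 2 ^ 1 by rewrite leq_exp2l.
  by have := prime_gt1 p_pr; lia.
have e_lt : e < 2 ^ b by apply: ltn_exp_size_bits.
have hE : h = 128 * n.+1 + uphalf b + (3 * uphalf b - a) by [].
have /andP[rb _] := uphalf_bounds b.
set B := 2 ^ (64 * n.+1 - 7).
have [] := @oracle_separation p e s t (2 ^ h) B p_pr e0 sp tp st.
- by apply: (@leq_trans (2 ^ 1)) => //; rewrite leq_exp2l //; lia.
- move=> N /andP[N0 N_le]; apply: divisor_bound_sweeps => //.
  apply: leq_ltn_trans N_le _.
  have : p ^ 2 < (2 ^ a) ^ 2 by rewrite ltn_exp2r.
  by rewrite -expnM mulnC expnD; lia.
(* In exponents: [12 + 2 b + 2 (64 n.+1 - 7) <= a - 1 + h], by [h >= 128 n.+1 + 4 uphalf b - a]. *)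
- have e2 : e ^ 2 < (2 ^ b) ^ 2 by rewrite ltn_exp2r.
  apply: (@leq_trans (2 ^ 12 * (2 ^ b) ^ 2 * B ^ 2)).
    by rewrite ltn_pmul2r ?expn_gt0 // ltn_pmul2l.
  apply: (@leq_trans (2 ^ a.-1 * 2 ^ h)); last by rewrite leq_mul2r a_le orbT.
  by rewrite /B -!expnM -!expnD leq_exp2l //; lia.
- apply: (@leq_trans (2 ^ 3 * 2 ^ b * B)).
    by rewrite ltn_pmul2r ?expn_gt0 // ltn_pmul2l.
  by rewrite /B -!expnM -!expnD leq_exp2l //; lia.
by move=> x xH nx; exists x; rewrite // mem_iota.
Qed.

(** The crude length bound [n.+1] for the first [n.+1] counter values suffices: it lets powers of
    [a] be absorbed into [2 ^ O(sweeps a)]. *)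
Lemma leq_sqr_sweeps a : a <= (sweeps a).+1 ^ 2.
Proof.
have [H _] := sweepsP a; apply: leq_trans H _; rewrite -mulnn.
by apply: wheel_dist_upper; rewrite expnS ltn_pmul2l // ltn_expl.
Qed.

(** [142 = 128 + 10 + 4]: the width, the constant [2 ^ 10], and [(a + 2) ^ 2 <= 2 ^ (4 n.+1)]. *)
Lemma runtime_bound a b : 0 < a -> b <= a ->
  runtime a b <= 2 ^ (142 * (sweeps a).+1 + uphalf b + (3 * uphalf b - a)).
Proof.
move=> a0 ba; set n := sweeps a.
have n_le : n <= a + 2 by apply: sweeps_leq.
have /andP[_ rb] := uphalf_bounds b.
have w_le : width a b <= 193 * (a + 2) by rewrite /width -/n; lia.
have sw : size (wheel n) <= a + 2.
  have [->//|n0] := posnP n.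
  have := exp_size_wheel_leq n0; have : n < 2 ^ n by apply: ltn_expl.
  move=> h1 h2; have : 2 ^ size (wheel n) < 2 ^ n.+1 by rewrite expnS; lia.
  by rewrite ltn_exp2l //; lia.
apply: (@leq_trans (2 ^ 10 * (a + 2) ^ 2 * 2 ^ width a b)).
  have W0 : 0 < 2 ^ width a b by rewrite expn_gt0.
  rewrite /runtime -/n.
  have h1 : (2 * width a b + 2 * a + 10) * 2 ^ width a b <= 400 * (a + 2) ^ 2 * 2 ^ width a b.
    by rewrite leq_mul2r; apply/orP; right; rewrite -mulnn; nia.
  have h2 : n * (132 + 2 * a) + (130 + size (wheel n)) + (4 * uphalf b).+1 + (a + width a b).+1
     <= 600 * (a + 2) ^ 2 by rewrite -mulnn; nia.
  have h3 : 600 * (a + 2) ^ 2 <= 600 * (a + 2) ^ 2 * 2 ^ width a b by rewrite leq_pmulr.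
  apply: leq_trans (leq_add (leq_trans h2 h3) h1) _.
  by rewrite -!mulnDl !leq_mul2r; apply/orP; right; apply/orP; right.
have a_sq : (a + 2) ^ 2 <= 2 ^ (4 * n.+1).
  rewrite (_ : 4 * n.+1 = (2 * n.+1) * 2); last by lia.
  rewrite expnM leq_exp2r //.
  have h1 : n.+1 ^ 2 <= (2 ^ n) ^ 2 by rewrite leq_exp2r // ltn_expl.
  have h2 := leq_trans (leq_sqr_sweeps a) h1.
  rewrite mulnC expnM (expnS 2 n) expnMn -[2 ^ 2]/4.
  have : 0 < (2 ^ n) ^ 2 by rewrite !expn_gt0.
  by lia.
apply: (@leq_trans (2 ^ 10 * 2 ^ (4 * n.+1) * 2 ^ width a b)).
  by rewrite leq_mul2r leq_mul2l a_sq !orbT.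
by rewrite -!expnD leq_exp2l // /width -/n; lia.
Qed.

(** * Asymptotics *)

Section RealBounds.
Local Open Scope R_scope.

Lemma INR_leq m n : (m <= n)%N -> INR m <= INR n.
Proof. by move=> /ssrnat.leP; apply: le_INR. Qed.

Lemma INR_ltn m n : (m < n)%N -> INR m < INR n.
Proof. by move=> /ssrnat.ltP; apply: lt_INR. Qed.

Lemma INR_muln m n : INR (m * n)%N = INR m * INR n.
Proof. exact: mult_INR. Qed.

Lemma INR_expn m n : INR (m ^ n)%N = INR m ^ n.
Proof. by elim: n => //= n IHn; rewrite expnS INR_muln IHn. Qed.

Lemma Rmult_divK x y : y <> 0 -> y * (x / y) = x.
Proof. by move=> y0; rewrite /Rdiv -Rmult_assoc Rinv_r_simpl_m. Qed.

Lemma Rlt_div_mul x y z : 0 < y -> x / y < z -> x < y * z.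
Proof.
move=> y0 H; rewrite -(@Rmult_divK x y); last by lra.
exact: Rmult_lt_compat_l.
Qed.

(** The 4 beyond the 142 of [runtime_bound] gives a factor of at least 16, which absorbs the
    rounding of [e] to powers of 2. *)
Definition overhead (p : nat) : nat := (146 * (sweeps (size (bits p))).+1)%N.

Definition exponent (p : nat) : R := INR (overhead p) * ln 2 / ln (INR p).

Lemma ln_INR_gt0 p : (1 < p)%N -> 0 < ln (INR p).
Proof. by move=> p1; rewrite -ln_1; apply: ln_increasing; [lra|apply: (@INR_ltn 1)]. Qed.

Lemma Rpower_exponent p : (1 < p)%N -> Rpower (INR p) (exponent p) = INR (2 ^ overhead p)%N.
Proof.
move=> p1; have lp := ln_INR_gt0 p1.
rewrite /Rpower /exponent /Rdiv Rmult_assoc Rinv_l ?Rmult_1_r; last by lra.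
by rewrite INR_expn -Rpower_pow // /=; lra.
Qed.

Lemma exponent_small eps : 0 < eps -> exists A : nat, forall a : nat, (A <= a)%N ->
  INR (146 * (sweeps a).+1)%N < eps * INR a.-1.
Proof.
move=> eps0.
(* As [584 = 4 * 146] and [1168 = 8 * 146], the terms [146 a / L] and [146 (2 ^ L + 1)] are at most
   [eps a / 4] and [eps a / 8]; together they stay below [eps (a - 1)] for [a >= 2]. *)
have [L L_gt] : exists L : nat, 584 / eps < INR L by have [L] := INR_unbounded (584 / eps); exists L.
have [A A_gt] : exists A : nat, 1168 * (2 ^ L + 1) / eps < INR A
  by have [A] := INR_unbounded (1168 * (2 ^ L + 1) / eps); exists A.
have L0 : 0 < INR L by apply: Rlt_trans L_gt; apply: Rdiv_lt_0_compat; lra.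
exists (maxn 2 A) => a; rewrite geq_max => /andP[a2 Aa].
have a1E : INR a = INR a.-1 + 1 by rewrite -S_INR prednK //; lia.
have a1_ge : 1 <= INR a.-1 by apply: (@INR_leq 1); lia.
have h1 : INR L * INR (sweeps a) <= INR L * 2 ^ L + INR a.
  have := INR_leq (sweeps_upper L a).
  by rewrite plus_INR !INR_muln INR_expn.
have h2 : 584 < eps * INR L by apply: Rlt_div_mul.
have h3 : 1168 * (2 ^ L + 1) < eps * INR a.
  by apply: Rlt_div_mul => //; have := INR_leq Aa; lra.
have h4 : INR (sweeps a) <= 2 ^ L + INR a / INR L.
  apply: (Rmult_le_reg_l (INR L)) => //; rewrite Rmult_plus_distr_l.
  by rewrite Rmult_divK //; lra.
have h5 : 146 * (INR a / INR L) <= eps * INR a / 4.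
  have a0 : 0 <= INR a by lra.
  apply: (Rmult_le_reg_l (INR L)) => //.
  rewrite (Rmult_comm 146) -Rmult_assoc Rmult_divK; last by lra.
  nra.
rewrite INR_muln (S_INR (sweeps a)) (_ : INR 146 = 146); last by rewrite INR_IZR_INZ.
nra.
Qed.

Lemma is_o1_exponent : is_o1 exponent.
Proof.
move=> eps eps0; have [A HA] := exponent_small eps0.
exists (2 ^ A.+1)%N => p p_ge; have p1 : (1 < p)%N.
  by apply: leq_trans p_ge; rewrite -[2%N]expn1 leq_exp2l.
have lp := ln_INR_gt0 p1; have p0 : (0 < p)%N by lia.
have l2 : 0 < ln 2 by apply: (@ln_INR_gt0 2).
set a := size (bits p).
have Aa : (A <= a)%N.
  have : (2 ^ A.+1 < 2 ^ a)%N by apply: leq_ltn_trans p_ge (ltn_exp_size_bits p).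
  by rewrite ltn_exp2l //; lia.
have lp_ge : INR a.-1 * ln 2 <= ln (INR p).
  rewrite -ln_pow; last by lra.
  have : 2 ^ a.-1 <= INR p by have := INR_leq (size_bits_exp_leq p0); rewrite INR_expn.
  have p2 : 0 < 2 ^ a.-1 by apply: pow_lt; lra.
  by case=> [/(ln_increasing _ _ p2)|->]; lra.
have G0 : 0 <= INR (overhead p) by apply: pos_INR.
have HG : INR (overhead p) < eps * INR a.-1 by apply: HA.
rewrite /exponent Rabs_pos_eq; last first.
  by apply: Rmult_le_pos; [nra|apply/Rlt_le/Rinv_0_lt_compat].
apply: (Rmult_lt_reg_r (ln (INR p))) => //.
rewrite /Rdiv Rmult_assoc Rinv_l ?Rmult_1_r; last by lra.
nra.
Qed.

(** If [3 r <= a], the truncated difference vanishes and [2 ^ r <= 2 sqrt e] gives the first term.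
    Otherwise the exponent contains [4 r - a], and [p <= 2 ^ a] with [2 ^ (4 r) <= 16 e ^ 2] gives
    the second. *)
Lemma runtime_max p e : (1 < p)%N -> (0 < e)%N -> (e <= p)%N ->
  INR (runtime (size (bits p)) (size (bits e))) <=
  Rmax (sqrt (INR e) * Rpower (INR p) (exponent p))
       (INR e * INR e * Rpower (INR p) (- (1) + exponent p)).
Proof.
move=> p1 e0 ep; set a := size (bits p); set b := size (bits e); set r := uphalf b.
have a0 : (0 < a)%N by rewrite lt0n; apply/eqP => a0; have := ltn_exp_size_bits p; rewrite -/a a0; lia.
have ba : (b <= a)%N by apply: size_bits_leq.
have T_le := INR_leq (runtime_bound a0 ba); rewrite -/r in T_le.
have p_pos : 0 < INR p by apply: (@INR_ltn 0); lia.
have e_pos : 0 < INR e by apply: (@INR_ltn 0).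
have r_le : (2 ^ (2 * r) <= 4 * e)%N.
  have /andP[_ rb] := uphalf_bounds b.
  apply: (@leq_trans (2 ^ (b.-1 + 2))); last first.
    by rewrite expnD mulnC leq_mul2l size_bits_exp_leq.
  rewrite leq_exp2l //; have : (0 < b)%N; last by move: rb; rewrite -/r; lia.
  by rewrite lt0n; apply/eqP => b0; have := ltn_exp_size_bits e; rewrite -/b b0; lia.
have overE : (2 ^ overhead p = 2 ^ (142 * (sweeps a).+1) * 2 ^ (4 * (sweeps a).+1))%N.
  by rewrite -expnD -mulnDl.
have over4 : (16 <= 2 ^ (4 * (sweeps a).+1))%N by rewrite -[16%N]/(2 ^ 4)%N leq_exp2l //; lia.
rewrite Rpower_plus Rpower_Ropp Rpower_1 // Rpower_exponent //.
set M := (2 ^ (142 * (sweeps a).+1))%N in overE.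
have overM : 16 * INR M <= INR (2 ^ overhead p)%N.
  have := INR_leq over4; rewrite overE INR_muln (_ : INR 16 = 16); last by rewrite INR_IZR_INZ.
  by have := pos_INR M; nra.
case: (leqP (3 * r) a) => ra.
  apply: Rle_trans (Rmax_l _ _); apply: Rle_trans T_le _.
  rewrite (_ : 3 * r - a = 0)%N; last by lia.
  rewrite addn0 expnD INR_muln -/M.
  have : INR (2 ^ r)%N <= 2 * sqrt (INR e).
    rewrite -(sqrt_Rsqr 2); last by lra.
    rewrite -sqrt_mult_alt; last by rewrite /Rsqr; lra.
    rewrite -(sqrt_Rsqr (INR _)); last exact: pos_INR.
    apply: sqrt_le_1_alt; have := INR_leq r_le.
    rewrite mulnC expnM -mulnn !INR_muln (_ : INR 4 = 4) /Rsqr; last by rewrite INR_IZR_INZ.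
    lra.
  have := sqrt_pos (INR e); have := pos_INR M; nra.
apply: Rle_trans (Rmax_r _ _); apply: Rle_trans T_le _.
apply: (Rmult_le_reg_r (INR p)) => //.
rewrite (Rmult_comm (/ _)) -/(Rdiv _ _) (Rmult_assoc _ _ (INR p)) (Rmult_comm (_ / _)).
rewrite Rmult_divK; last by lra.
have p_le : INR p <= INR (2 ^ a)%N by apply/INR_leq/ltnW/ltn_exp_size_bits.
have T0 := pos_INR (2 ^ (142 * (sweeps a).+1 + r + (3 * r - a)))%N.
apply: Rle_trans (Rmult_le_compat_l _ _ _ T0 p_le) _.
rewrite -[X in X <= _]INR_muln -expnD (_ : 142 * (sweeps a).+1 + r + (3 * r - a) + a = 142 * (sweeps a).+1 + (2 * r) * 2)%N; last by lia.
rewrite expnD (expnM 2 (2 * r) 2) -/M -mulnn !INR_muln.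
have := INR_leq r_le; rewrite INR_muln (_ : INR 4 = 4); last by rewrite INR_IZR_INZ.
have := pos_INR (2 ^ (2 * r))%N; have := pos_INR M.
move: (INR (2 ^ (2 * r))%N) (INR M) (INR (2 ^ overhead p)%N) overM => x m o overM m0 x0 x4.
apply: (@Rle_trans _ (m * (16 * (INR e * INR e)))); first by apply: Rmult_le_compat_l; nra.
by have : 0 < INR e * INR e; nra.
Qed.
End RealBounds.

Theorem theorem3p12 :
  exists (M : OTM) (f : nat -> R), is_o1 f /\
    forall p e s t : nat,
      prime p -> (0 < e)%N -> (e %| p - 1)%N -> (e <= (p - 1) %/ 2)%N ->
      (s < p)%N -> (t < p)%N ->
      exists n : nat,
        Rle (INR n)
            (Rmax (Rmult (sqrt (INR e)) (Rpower (INR p) (f p)))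
                  (Rmult (Rmult (INR e) (INR e))
                         (Rpower (INR p) (Rplus (Ropp 1) (f p))))) /\
        halts_within M p e (oracle p e s) (oracle p e t) n (s == t).
Proof.
exists machine, exponent; split; first exact: is_o1_exponent.
move=> p e s t p_pr e0 ep _ sp tp; have p1 := prime_gt1 p_pr.
exists (runtime (size (bits p)) (size (bits e))); split.
  by apply: runtime_max => //; have := dvdn_leq _ ep; lia.
rewrite -(agreement_decides p_pr e0 sp tp); apply: machine_halts => x.
by apply: size_bits_leq; rewrite ltnW // ltn_mod; lia.
Qed.
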